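(* Let $(K,v)$ be a field with a (possibly trivial, not necessarily complete) non-archimedean valuation, let $M$ be a free abelian group of finite rank, $T=\operatorname{Spec}(K[M])$, and let $X$ be a closed subscheme of $T$. Then $$\operatorname{trop}_v(X^{\rm an})=\{\omega\in N_{\mathbb R}\mid \operatorname{in}_\omega(X)\neq\emptyset\}.$$ That is, the tropical variety $\operatorname{Trop}_v(X):=\operatorname{trop}_v(X^{\rm an})$ is also equal to the set of all $\omega\in N_{\mathbb R}$ at which the initial degeneration $\operatorname{in}_\omega(X)$ is non-empty.
   Context: Notation: $v=-\log|\cdot|$ for a non-archimedean absolute value on $K$, with valuation ring $K^\circ$ and residue field $\tilde K$. $N=\operatorname{Hom}(M,\mathbb Z)$, $N_{\mathbb R}=\operatorname{Hom}(M,\mathbb R)$, pairing $\langle u,\omega\rangle=\omega(u)$; $\chi^u$ is the character of $T$ given by $u\in M$. $\mathbb T=\operatorname{Spec}(K^\circ[M])$ is the split torus over $K^\circ$ with generic fibre $T$; for a $K^\circ$-algebra $A$, $\mathbb T_A$ is its base change. $X^{\rm an}$ (Berkovich analytification) is the set of multiplicative seminorms $p$ on the coordinate ring of $X$ extending $|\cdot|$ on $K$ (equivalently, one works over the completion of $K$). The map $\operatorname{trop}_v:T^{\rm an}\to N_{\mathbb R}$ is defined by $\langle u,\operatorname{trop}_v(p)\rangle=-\log p(\chi^u)$ for $u\in M$, and $X^{\rm an}\subset T^{\rm an}$. Closure: if $\mathscr X$ is a flat $K^\circ$-scheme with generic fibre $\mathscr X_\eta$ and $Y\subset\mathscr X_\eta$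 is a closed subscheme, the closure of $Y$ in $\mathscr X$ is the unique closed subscheme of $\mathscr X$ which is flat over $K^\circ$ and has generic fibre $Y$ (for $\mathscr X=\operatorname{Spec}A$ it is given by the ideal $I_Y\cap A$). Initial degeneration: let $(L,w)$ be a valued field extending $(K,v)$ and $t\in T(L)$. Then $\operatorname{in}_t(X)$ is the special fibre of the closure of $t^{-1}X_L$ in $\mathbb T_{L^\circ}$, a closed subscheme of $\mathbb T_{\tilde L}$. Given $\omega\in N_{\mathbb R}$, choose $(L,w)$ and $t\in T(L)$ with $\operatorname{trop}_w(t)=\omega$ (i.e. $w(\chi^u(t))=\langle u,\omega\rangle$ for all $u\in M$) and put $\operatorname{in}_\omega(X):=\operatorname{in}_t(X)$. It is well-defined up to base change of the residue field and translation by a torus point over an extension of the residue field; in particular its non-emptiness depends only on $\omega$. *)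

(* Defs.v *)
From HB Require Import structures.
From mathcomp Require Import all_boot all_order all_algebra finmap.
From mathcomp Require Import generic_quotient ring_quotient.
From mathcomp Require Import boolp classical_sets reals exp.
From mathcomp Require Import monalg.

Set Implicit Arguments.
Unset Strict Implicit.
Unset Printing Implicit Defensive.

Import Order.TTheory GRing.Theory Num.Theory.

Local Open Scope classical_set_scope.
Local Open Scope ring_scope.

Definition free_of_finite_rank (M : zmodType) : Prop :=
  exists (n : nat) (b : 'I_n -> M),
    bijective (fun c : 'rV[int]_n => \sum_(i < n) b i *~ c 0 i).

(* [monalg] only makes {malg A[M]} a ring when the exponent monoid has no
   invertible element other than its unit, so the convolution product for a
   group of exponents is defined here. *)
Definition grpalg (A : comNzRingType) (M : zmodType) : Type := {malg A[M]}.

HB.instance Definition _ (A : comNzRingType) (M : zmodType) :=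
  GRing.Lmodule.copy (grpalg A M) {malg A[M]}.

Section GroupAlgebra.
Context (A : comNzRingType) (M : zmodType).
Implicit Types (f g h : grpalg A M) (u : M) (a : A).

Definition ga_coef u f : A := mcoeff u f.
Definition ga_supp f : {fset M} := msupp f.

Definition ga_monom a u : grpalg A M := mkmalgU u a.

Definition chi u : grpalg A M := ga_monom 1 u.

Definition ga_mul f g : grpalg A M :=
  \sum_(u <- ga_supp f) \sum_(v <- ga_supp g)
     ga_monom (ga_coef u f * ga_coef v g) (u + v).

Lemma ga_coefP f g : (forall u, ga_coef u f = ga_coef u g) -> f = g.
Proof. by move/malgP. Qed.

Lemma ga_coefD u f g : ga_coef u (f + g) = ga_coef u f + ga_coef u g.
Proof. exact: mcoeffD. Qed.

Lemma ga_coefZ u a f : ga_coef u (a *: f) = a * ga_coef u f.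
Proof. exact: mcoeffZ. Qed.

Lemma ga_coef_monom u v a : ga_coef u (ga_monom a v) = a *+ (v == u).
Proof. exact: mcoeffU. Qed.

Lemma ga_monomD u : {morph ga_monom^~ u : a b / a + b}.
Proof. exact: monalgUD. Qed.

Lemma ga_monom0 u : ga_monom 0 u = 0.
Proof. exact: monalgU0. Qed.

Lemma ga_coef_outsupp u f : u \notin ga_supp f -> ga_coef u f = 0.
Proof. exact: mcoeff_outdom. Qed.

Lemma ga_sum f : f = \sum_(u <- ga_supp f) ga_monom (ga_coef u f) u.
Proof. exact: monalgE. Qed.

Lemma ga_mulw (d1 d2 : {fset M}) f g :
  (ga_supp f `<=` d1)%fset -> (ga_supp g `<=` d2)%fset ->
  ga_mul f g = \sum_(u <- d1) \sum_(v <- d2)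
     ga_monom (ga_coef u f * ga_coef v g) (u + v).
Proof.
move=> le1 le2; rewrite /ga_mul (big_fset_incl _ le1) /=.
  apply/eq_bigr=> u _; apply/big_fset_incl => // v _ /ga_coef_outsupp ->.
  by rewrite mulr0 ga_monom0.
move=> u _ /ga_coef_outsupp fu; rewrite big1 // => v _.
by rewrite fu mul0r ga_monom0.
Qed.

Lemma ga_mulC : commutative ga_mul.
Proof.
move=> f g; rewrite /ga_mul exchange_big; apply: eq_bigr => v _.
by apply: eq_bigr => u _; rewrite mulrC addrC.
Qed.

Lemma ga_mulDl : left_distributive ga_mul +%R.
Proof.
move=> f g h; pose d := (ga_supp f `|` ga_supp g)%fset.
have ld : (ga_supp (f + g)%R `<=` d)%fset by exact: msuppD_le.
rewrite (ga_mulw ld (fsubset_refl _)).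
rewrite (ga_mulw (fsubsetUl (ga_supp f) (ga_supp g)) (fsubset_refl (ga_supp h))).
rewrite (ga_mulw (fsubsetUr (ga_supp f) (ga_supp g)) (fsubset_refl (ga_supp h))).
rewrite -big_split; apply: eq_bigr => u _; rewrite -big_split.
by apply: eq_bigr => v _; rewrite ga_coefD mulrDl ga_monomD.
Qed.

Lemma ga_mulDr : right_distributive ga_mul +%R.
Proof. by move=> f g h; rewrite !(ga_mulC f) ga_mulDl. Qed.

Lemma ga_mul0g f : ga_mul 0 f = 0.
Proof. by apply: (addrI (ga_mul 0 f)); rewrite -ga_mulDl !addr0. Qed.

Lemma ga_suml (I : Type) (r : seq I) (F : I -> grpalg A M) g :
  ga_mul (\sum_(i <- r) F i) g = \sum_(i <- r) ga_mul (F i) g.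
Proof.
elim: r => [|i r IH]; first by rewrite !big_nil ga_mul0g.
by rewrite !big_cons ga_mulDl IH.
Qed.

Lemma ga_sumr (I : Type) (r : seq I) (F : I -> grpalg A M) g :
  ga_mul g (\sum_(i <- r) F i) = \sum_(i <- r) ga_mul g (F i).
Proof.
by rewrite ga_mulC ga_suml; apply: eq_bigr => i _; rewrite ga_mulC.
Qed.

Lemma ga_mul_monom a b u v :
  ga_mul (ga_monom a u) (ga_monom b v) = ga_monom (a * b) (u + v).
Proof.
by rewrite (ga_mulw msuppU_le msuppU_le) !big_seq_fset1 !ga_coef_monom !eqxx.
Qed.

Lemma ga_mulA : associative ga_mul.
Proof.
move=> f g h; rewrite (ga_sum f) !ga_suml; apply: eq_bigr => u _.
rewrite (ga_sum g) ga_sumr !ga_suml ga_sumr; apply: eq_bigr => v _.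
rewrite (ga_sum h) !ga_sumr; apply: eq_bigr => w _.
by rewrite !ga_mul_monom mulrA addrA.
Qed.

Lemma ga_mul1g : left_id (chi 0) ga_mul.
Proof.
move=> f; rewrite {1}(ga_sum f) ga_sumr [RHS](ga_sum f); apply: eq_bigr => u _.
by rewrite ga_mul_monom mul1r add0r.
Qed.

Lemma chi0_neq0 : chi 0 != 0.
Proof. by rewrite /chi /ga_monom monalgU_eq0 oner_neq0. Qed.

HB.instance Definition _ := GRing.Zmodule_isComNzRing.Build (grpalg A M)
  ga_mulA ga_mulC ga_mul1g ga_mulDl chi0_neq0.

Lemma ga_scalerE a f : a *: f = ga_mul (ga_monom a 0) f.
Proof.
rewrite [in RHS](ga_sum f) ga_sumr malgZ_def; apply: eq_bigr => u _.
by rewrite ga_mul_monom add0r.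
Qed.

Lemma ga_scalerAl a f g : a *: (f * g) = (a *: f) * g.
Proof. by rewrite !ga_scalerE; exact: ga_mulA. Qed.

HB.instance Definition _ :=
  GRing.Lmodule_isLalgebra.Build A (grpalg A M) ga_scalerAl.

Lemma ga_monomM a b u v : ga_monom a u * ga_monom b v = ga_monom (a * b) (u + v).
Proof. exact: ga_mul_monom. Qed.

Lemma chi0 : chi 0 = 1. Proof. by []. Qed.

Lemma chiD u v : chi (u + v) = chi u * chi v.
Proof. by rewrite /chi ga_monomM mulr1. Qed.

Lemma chi_unit u : chi u * chi (- u) = 1.
Proof. by rewrite -chiD subrr. Qed.

End GroupAlgebra.

Arguments chi {A M} u.

Section CoefficientMorphisms.
Context (A B : comNzRingType) (M : zmodType) (phi : {rmorphism A -> B}).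

Definition ga_mor (t : M -> B) (f : grpalg A M) : grpalg B M :=
  \sum_(u <- ga_supp f) ga_monom (phi (ga_coef u f) * t u) u.

Lemma ga_morE t f u : ga_coef u (ga_mor t f) = phi (ga_coef u f) * t u.
Proof.
rewrite /ga_coef raddf_sum /=.
have [uf|uNf] := boolP (u \in ga_supp f).
  rewrite (big_fsetD1 u) //= mcoeffUU big1_fset ?addr0 // => v.
  by rewrite in_fsetD1 mcoeffU; case: eqP.
rewrite (mcoeff_outdom uNf) rmorph0 mul0r big1_fset // => v vf _.
by rewrite mcoeffU; case: eqP uNf => // <-; rewrite vf.
Qed.

Lemma ga_mor_is_zmod t : zmod_morphism (ga_mor t).
Proof.
move=> f g; apply: ga_coefP => u.
rewrite ga_morE /ga_coef !mcoeffB -!/(ga_coef _ _) !ga_morE.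
by rewrite rmorphB mulrBl.
Qed.

Lemma ga_mor_monom t a u : ga_mor t (ga_monom a u) = ga_monom (phi a * t u) u.
Proof.
apply: ga_coefP => v; rewrite ga_morE !ga_coef_monom.
by case: eqP => [->|_] //=; rewrite !mulr0n rmorph0 mul0r.
Qed.

Lemma ga_mor_is_monoid t :
  t 0 = 1 -> {morph t : u v / u + v >-> u * v} -> monoid_morphism (ga_mor t).
Proof.
move=> t0 tD; split; first by rewrite -chi0 ga_mor_monom rmorph1 t0 mulr1.
pose h : {additive grpalg A M -> grpalg B M} := HB.pack (ga_mor t)
  (GRing.isZmodMorphism.Build _ _ (ga_mor t) (ga_mor_is_zmod t)).
move=> f g; rewrite -![ga_mor t _]/(h _) {1}(ga_sum f) [in RHS](ga_sum f).
rewrite mulr_suml !(raddf_sum h) mulr_suml; apply: eq_bigr => u _.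
rewrite {1}(ga_sum g) [in RHS](ga_sum g).
rewrite mulr_sumr !(raddf_sum h) mulr_sumr; apply: eq_bigr => v _.
by rewrite ga_monomM /= !ga_mor_monom ga_monomM tD rmorphM mulrACA.
Qed.

End CoefficientMorphisms.

(* A[M] -> B[M] induced by A -> B, i.e. the projection T_B -> T_A. *)
Definition ga_map (A B : comNzRingType) (M : zmodType)
  (phi : {rmorphism A -> B}) : grpalg A M -> grpalg B M :=
  ga_mor phi (fun=> 1).

Section GaMap.
Context (A B : comNzRingType) (M : zmodType) (phi : {rmorphism A -> B}).

Let ga_map_is_monoid : monoid_morphism (@ga_map A B M phi).
Proof. by apply: ga_mor_is_monoid => // u v; rewrite mulr1. Qed.

HB.instance Definition _ := GRing.isZmodMorphism.Build _ _
  (@ga_map A B M phi) (@ga_mor_is_zmod A B M phi (fun=> 1)).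
HB.instance Definition _ := GRing.isMonoidMorphism.Build _ _
  (@ga_map A B M phi) ga_map_is_monoid.
End GaMap.

(* A closed subscheme of Spec A is given by an ideal of A; the unit ideal
   (empty subscheme) is allowed. *)
Record ideal (A : comNzRingType) := Ideal {
  ideal_set :> set A;
  ideal0 : ideal_set 0;
  idealD : forall x y, ideal_set x -> ideal_set y -> ideal_set (x + y);
  idealM : forall a x, ideal_set x -> ideal_set (a * x) }.

Definition is_prime (A : comNzRingType) (P : ideal A) : Prop :=
  ~ ideal_set P 1 /\
  forall x y, ideal_set P (x * y) -> ideal_set P x \/ ideal_set P y.

(* Underlying set of the closed subscheme V(I) of Spec A. *)
Definition points (A : comNzRingType) (I : ideal A) : set (ideal A) :=
  [set P | is_prime P /\ I `<=` P].

Section GeneratedIdeal.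
Context (A : comNzRingType) (S : set A).

Definition ideal_gen_set : set A := [set x | forall J : ideal A, S `<=` J -> ideal_set J x].

Let gen0 : ideal_gen_set 0.
Proof. by move=> J _; exact: ideal0. Qed.

Let genD x y : ideal_gen_set x -> ideal_gen_set y -> ideal_gen_set (x + y).
Proof. by move=> hx hy J SJ; apply: idealD; [exact: hx|exact: hy]. Qed.

Let genM a x : ideal_gen_set x -> ideal_gen_set (a * x).
Proof. by move=> hx J SJ; apply: idealM; exact: hx. Qed.

Definition ideal_gen : ideal A := Ideal gen0 genD genM.
End GeneratedIdeal.

Section IdealTransfer.
Context (A B : comNzRingType) (phi : {rmorphism A -> B}).

(* Ideal of the scheme-theoretic inverse image of V(I) under
   Spec B -> Spec A. *)
Definition ideal_ext (I : ideal A) : ideal B := ideal_gen (phi @` I).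

Section Contraction.
Variable J : ideal B.

Let contr0 : (phi @^-1` J) 0.
Proof. by rewrite /preimage /= rmorph0; exact: ideal0. Qed.

Let contrD x y : (phi @^-1` J) x -> (phi @^-1` J) y -> (phi @^-1` J) (x + y).
Proof. by rewrite /preimage /= rmorphD; exact: idealD. Qed.

Let contrM a x : (phi @^-1` J) x -> (phi @^-1` J) (a * x).
Proof. by rewrite /preimage /= rmorphM; exact: idealM. Qed.

Definition ideal_contr : ideal A := Ideal contr0 contrD contrM.
End Contraction.
End IdealTransfer.

(* The coordinate ring A/I of V(I). The quotient rings of [ring_quotient]
   require I to be proper. *)
Section CoordinateRing.
Local Open Scope quotient_scope.
Context (A : comNzRingType) (I : ideal A).

Definition ideal_pred : {pred A} := fun x => `[< ideal_set I x >].

Let ideal_pred_zmod : zmod_closed ideal_pred.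
Proof.
split=> [|x y /asboolP Ix /asboolP Iy]; apply/asboolP; first exact: ideal0.
by apply: idealD => //; rewrite -mulN1r; apply: idealM.
Qed.

HB.instance Definition _ := GRing.isZmodClosed.Build A ideal_pred ideal_pred_zmod.

Definition coord_ring : Type := {ideal_quot ideal_pred}.

HB.instance Definition _ := GRing.Zmodule.on coord_ring.
HB.instance Definition _ := EqQuotient.on coord_ring.

Definition coord : A -> coord_ring := \pi_coord_ring.

Lemma coord_eq x y : coord x = coord y <-> ideal_set I (x - y).
Proof.
rewrite /coord; split=> [/eqP|Ixy]; last (apply/eqP; move: Ixy => /asboolP).
  by rewrite -Quotient.idealrBE => /asboolP.
by rewrite -[asbool _]/(x - y \in ideal_pred) Quotient.idealrBE.
Qed.

Lemma coordK q : coord (repr q) = q. Proof. exact: reprK. Qed.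

Lemma coord_is_zmod : zmod_morphism coord.
Proof. exact: pi_is_zmod_morphism. Qed.

HB.instance Definition _ :=
  GRing.isZmodMorphism.Build A coord_ring coord coord_is_zmod.

Definition coord_mul (p q : coord_ring) : coord_ring :=
  coord (repr p * repr q).

Lemma coord_mulE x y : coord (x * y) = coord_mul (coord x) (coord y).
Proof.
have eqM a b c d : coord a = coord b -> coord c = coord d ->
    coord (a * c) = coord (b * d).
  move=> /coord_eq ab /coord_eq cd; apply/coord_eq.
  have -> : a * c - b * d = c * (a - b) + b * (c - d).
    by rewrite !mulrBr addrA (mulrC c a) (mulrC c b) subrK.
  by apply: idealD; apply: idealM.
by apply: eqM; rewrite coordK.
Qed.

Let coord_mulA : associative coord_mul.
Proof.
move=> p q r; rewrite -[p]coordK -[q]coordK -[r]coordK.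
by rewrite -!coord_mulE mulrA.
Qed.

Let coord_mulC : commutative coord_mul.
Proof. by move=> p q; rewrite /coord_mul mulrC. Qed.

Let coord_mul1 : left_id (coord 1) coord_mul.
Proof. by move=> p; rewrite -[p]coordK -coord_mulE mul1r. Qed.

Let coord_mulDl : left_distributive coord_mul +%R.
Proof.
move=> p q r; rewrite -[p]coordK -[q]coordK -[r]coordK -raddfD.
by rewrite -!coord_mulE mulrDl raddfD.
Qed.

HB.instance Definition _ := GRing.Zmodule_isComPzRing.Build coord_ring
  coord_mulA coord_mulC coord_mul1 coord_mulDl.

Let coord_is_monoid : monoid_morphism coord.
Proof. by split=> // x y; exact: coord_mulE. Qed.

HB.instance Definition _ :=
  GRing.isMonoidMorphism.Build A coord_ring coord coord_is_monoid.
End CoordinateRing.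

Arguments coord {A} I x.

(* The valuation is v = - ln |.|; the trivial one is |x| = 1 for x <> 0. *)
Record absval (R : realType) (K : fieldType) := AbsVal {
  absv :> K -> R;
  absv_ge0 : forall x, 0 <= absv x;
  absv_eq0 : forall x, (absv x == 0) = (x == 0);
  absvM : forall x y, absv (x * y) = absv x * absv y;
  absv_ultra : forall x y, absv (x + y) <= Num.max (absv x) (absv y) }.

Section ValuationRing.
Context (R : realType) (L : fieldType) (w : absval R L).

Lemma absv1 : w 1 = 1.
Proof.
have w1 : w 1 != 0 by rewrite absv_eq0 oner_neq0.
by apply: (mulfI w1); rewrite -absvM !mulr1.
Qed.

Lemma absvN x : w (- x) = w x.
Proof.
have wN1 : w (-1) = 1.
  apply/eqP; rewrite -(@eqrXn2 _ 2) ?absv_ge0 ?ler01 //.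
  by rewrite expr1n expr2 -absvM mulrNN mulr1 absv1.
by rewrite -mulN1r absvM wN1 mul1r.
Qed.

Definition valring_pred : {pred L} := [pred x | w x <= 1].

Let valring_subring : subring_closed valring_pred.
Proof.
split=> [|x y|x y]; rewrite !inE ?absv1 // => x1 y1.
  by rewrite (le_trans (absv_ultra _ _ _)) // absvN ge_max x1.
by rewrite absvM mulr_ile1 ?absv_ge0.
Qed.

HB.instance Definition _ :=
  GRing.isSubringClosed.Build L valring_pred valring_subring.

Record valring := ValRing { valring_val : L; _ : valring_val \in valring_pred }.

HB.instance Definition _ := [isSub for valring_val].
HB.instance Definition _ := [Choice of valring by <:].
HB.instance Definition _ := [SubChoice_isSubComNzRing of valring by <:].

Let valring_val_is_zmod : zmod_morphism valring_val.
Proof. exact: (raddfB (val : valring -> L)). Qed.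
Let valring_val_is_monoid : monoid_morphism valring_val.
Proof.
by split; [exact: (rmorph1 (val : valring -> L))|
           exact: (rmorphM (val : valring -> L))].
Qed.
HB.instance Definition _ :=
  GRing.isZmodMorphism.Build valring L valring_val valring_val_is_zmod.
HB.instance Definition _ :=
  GRing.isMonoidMorphism.Build valring L valring_val valring_val_is_monoid.

Definition maxideal : {pred valring} := [pred x | w (valring_val x) < 1].

Let maxideal_idealr : idealr_closed maxideal.
Proof.
split=> [||a x y]; rewrite !inE.
- by rewrite raddf0 (eqP (_ : w 0 == 0)) ?absv_eq0 // ltr01.
- by rewrite rmorph1 absv1 ltxx.
move=> x1 y1; rewrite raddfD /=.
rewrite (le_lt_trans (absv_ultra _ _ _)) // gt_max y1 andbT absvM.
have a1 : w (valring_val a) <= 1 by case: a.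
by rewrite (le_lt_trans _ x1) // ler_piMl ?absv_ge0.
Qed.

HB.instance Definition _ := isIdealr.Build valring maxideal maxideal_idealr.

Definition resfield : Type := {ideal_quot maxideal}.
HB.instance Definition _ := GRing.ComNzRing.on resfield.

Definition reduction : valring -> resfield := (\pi_({ideal_quot maxideal}))%qT.

Let reduction_is_zmod : zmod_morphism reduction.
Proof. exact: pi_is_zmod_morphism. Qed.
Let reduction_is_monoid : monoid_morphism reduction.
Proof. exact: pi_is_monoid_morphism. Qed.
HB.instance Definition _ :=
  GRing.isZmodMorphism.Build valring resfield reduction reduction_is_zmod.
HB.instance Definition _ :=
  GRing.isMonoidMorphism.Build valring resfield reduction reduction_is_monoid.


Let resfield_inv (q : resfield) : resfield :=
  if q == 0 then 0 else
  reduction (insubd 0 (valring_val (repr (q : {ideal_quot maxideal})))^-1).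

Let resfield_mulVf q : q != 0 -> resfield_inv q * q = 1.
Proof.
rewrite /resfield_inv => q0; rewrite (negbTE q0).
set x := repr _.
have qE : q = reduction x by rewrite /reduction /x reprK.
have x1 : w (valring_val x) = 1.
  apply/eqP; rewrite eq_le; apply/andP; split; first by case: (x).
  rewrite leNgt; apply: contra q0 => xm; rewrite qE.
  rewrite -(rmorph0 (reduction : {rmorphism valring -> resfield})).
  by rewrite /reduction -Quotient.idealrBE subr0.
have x0 : valring_val x != 0 by rewrite -(absv_eq0 w) x1 oner_neq0.
have Vx1 : (valring_val x)^-1 \in valring_pred.
  rewrite inE; have -> : w (valring_val x)^-1 = 1; last by [].
  by rewrite -[LHS]mulr1 -x1 -absvM mulVf // absv1.
rewrite [in X in _ * X]qE -rmorphM.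
rewrite -(rmorph1 (reduction : {rmorphism valring -> resfield})).
congr reduction; apply: val_inj; rewrite rmorphM rmorph1 /=.
by rewrite [X in X * _]insubdK // mulVf.
Qed.

Let resfield_inv0 : resfield_inv 0 = 0.
Proof. by rewrite /resfield_inv eqxx. Qed.

HB.instance Definition _ :=
  GRing.ComNzRing_isField.Build resfield resfield_mulVf resfield_inv0.
End ValuationRing.

Record valued_ext (R : realType) (K : fieldType) (v : absval R K) := ValuedExt {
  ext_field :> fieldType;
  ext_abs : absval R ext_field;
  ext_map : {rmorphism K -> ext_field};
  ext_absE : forall x, ext_abs (ext_map x) = v x }.

(* (Spec A)^an for the K-algebra structure j : K -> A.  The values p 0 = 0 and
   p 1 = 1 are forced by [sn_ext]. *)
Record analytification (R : realType) (K : fieldType) (v : absval R K)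
    (A : comPzRingType) (j : K -> A) := Seminorm {
  sn :> A -> R;
  sn_ge0 : forall f, 0 <= sn f;
  snD : forall f g, sn (f + g) <= sn f + sn g;
  snM : forall f g, sn (f * g) = sn f * sn g;
  sn_ext : forall c, sn (j c) = v c }.

Section AnPull.
Context (R : realType) (K : fieldType) (v : absval R K).
Context (A B : comPzRingType) (j : K -> A) (phi : {rmorphism A -> B}).
Variable p : analytification v (phi \o j).

Let pull_ge0 f : 0 <= p (phi f). Proof. exact: sn_ge0. Qed.
Let pullD f g : p (phi (f + g)) <= p (phi f) + p (phi g).
Proof. by rewrite rmorphD; exact: snD. Qed.
Let pullM f g : p (phi (f * g)) = p (phi f) * p (phi g).
Proof. by rewrite rmorphM; exact: snM. Qed.
Let pull_ext c : p (phi (j c)) = v c. Proof. exact: sn_ext p c. Qed.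

(* The map (Spec B)^an -> (Spec A)^an. *)
Definition an_pull : analytification v j :=
  @Seminorm R K v A j (fun f => p (phi f)) pull_ge0 pullD pullM pull_ext.
End AnPull.

Section Tropicalization.
Context (R : realType) (K : fieldType) (v : absval R K) (M : zmodType).

Definition torus_scalar (c : K) : grpalg K M := c%:A.

Definition torus_an : Type := analytification v torus_scalar.

Definition subscheme_an (X : ideal (grpalg K M)) : Type :=
  analytification v (coord X \o torus_scalar).

Definition an_incl (X : ideal (grpalg K M)) (p : subscheme_an X) : torus_an :=
  an_pull p.

Section Trop.
Variable p : torus_an.

Lemma sn_chi_gt0 u : 0 < p (chi u).
Proof.
rewrite lt_neqAle sn_ge0 andbT eq_sym.
have p1 : p 1 = 1.
  by rewrite -(absv1 v) -(sn_ext p) /torus_scalar scale1r.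
apply: contra_eqN p1 => /eqP pu; rewrite -(chi_unit K u) snM pu mul0r.
by rewrite eq_sym oner_neq0.
Qed.

(* [ln] is only applied to positive numbers, by [sn_chi_gt0]. *)
Definition trop_fun (u : M) : R := - ln (p (chi u)).

Let trop_is_zmod : zmod_morphism trop_fun.
Proof.
have tD a b : trop_fun (a + b) = trop_fun a + trop_fun b.
  by rewrite /trop_fun chiD snM lnM ?posrE ?sn_chi_gt0 // opprD.
by move=> a b; rewrite -[in RHS](subrK b a) (tD (a - b)) addrK.
Qed.

HB.instance Definition _ := GRing.isZmodMorphism.Build M R trop_fun trop_is_zmod.

(* N_R = Hom(M, R) is rendered as {additive M -> R}. *)
Definition trop : {additive M -> R} := trop_fun.
End Trop.

Definition tropical_variety (X : ideal (grpalg K M)) : set {additive M -> R} :=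
  [set trop (an_incl p) | p in [set: subscheme_an X]].

End Tropicalization.

(* T(L) for T = Spec K[M]. *)
Record torus_point (K L : fieldType) (iota : {rmorphism K -> L}) (M : zmodType) :=
  TorusPoint {
    tpoint :> {rmorphism grpalg K M -> L};
    tpoint_alg : forall c : K, tpoint c%:A = iota c }.

(* Comorphism chi^u |-> chi^u(t) chi^u of the translation x |-> t x of T_L. *)
Definition translation (K L : fieldType) (iota : {rmorphism K -> L})
    (M : zmodType) (t : torus_point iota M) : grpalg L M -> grpalg L M :=
  ga_mor idfun (fun u => t (chi u)).

Section Translation.
Context (K L : fieldType) (iota : {rmorphism K -> L}) (M : zmodType).
Variable t : torus_point iota M.

Let translation_is_monoid : monoid_morphism (translation t).
Proof.
by apply: ga_mor_is_monoid => [|u v]; rewrite ?chi0 ?rmorph1 // chiD rmorphM.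
Qed.

HB.instance Definition _ := GRing.isZmodMorphism.Build _ _ (translation t)
  (@ga_mor_is_zmod L L M idfun (fun u => t (chi u))).
HB.instance Definition _ := GRing.isMonoidMorphism.Build _ _ (translation t)
  translation_is_monoid.
End Translation.

Section InitialDegeneration.
Context (R : realType) (K : fieldType) (v : absval R K) (M : zmodType).
Context (L : valued_ext v) (t : torus_point (ext_map L) M).
Variable X : ideal (grpalg K M).

Definition base_change : ideal (grpalg L M) := ideal_ext (ga_map (ext_map L)) X.

(* t^-1 X_L is the inverse image of X_L under x |-> t x. *)
Definition translate : ideal (grpalg L M) :=
  ideal_ext (translation t) base_change.

(* The closure of V(Y) in T_{L^o} is given by the ideal Y cap L^o[M]. *)
Definition closure_ideal (Y : ideal (grpalg L M)) :
    ideal (grpalg (valring (ext_abs L)) M) :=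
  ideal_contr (ga_map (@valring_val _ _ (ext_abs L))) Y.

Definition special_fibre (Z : ideal (grpalg (valring (ext_abs L)) M)) :
    ideal (grpalg (resfield (ext_abs L)) M) :=
  ideal_ext (ga_map (@reduction _ _ (ext_abs L))) Z.

Definition initial_degeneration : ideal (grpalg (resfield (ext_abs L)) M) :=
  special_fibre (closure_ideal translate).
End InitialDegeneration.

(* A valued extension (L, w) and t in T(L) with trop_w(t) = omega.  Each
   chi^u(t) is a unit of L, so [ln] is only applied to positive numbers. *)
Record point_over (R : realType) (K : fieldType) (v : absval R K) (M : zmodType)
    (omega : {additive M -> R}) := PointOver {
  pt_ext : valued_ext v;
  pt : torus_point (ext_map pt_ext) M;
  pt_trop : forall u : M, - ln (ext_abs pt_ext (pt (chi u))) = omega u }.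

Arguments point_over {R K} v {M} omega.

(* in_omega(X), as computed with the choice D of (L, w) and t. *)
Definition init_at (R : realType) (K : fieldType) (v : absval R K) (M : zmodType)
    (omega : {additive M -> R}) (D : point_over v omega) (X : ideal (grpalg K M)) :
    ideal (grpalg (resfield (ext_abs (pt_ext D))) M) :=
  initial_degeneration (pt D) X.

(* Main.v *)
Require Import Defs.
From HB Require Import structures.
From mathcomp Require Import all_boot all_order all_algebra finmap monalg.
From mathcomp Require Import generic_quotient ring_quotient fraction.
From mathcomp Require Import boolp classical_sets reals sequences exp.
From mathcomp Require Import lra ring.

(* Both conditions on omega are equivalent to the following one: no f in the
   ideal of X has all terms of 1 + f of absolute value < 1 at omega.

   If there is no such f, the quotient of the Gauss norm of weight omega by the
   ideal of X gives 1 the value 1. As in Berkovich's proof that spectra are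
   non-empty, a minimal seminorm below it is multiplicative, and it is a point of
   X^an above omega. Conversely a point of X^an is ultrametric, so that it would
   give 1 a value < 1 if such an f existed.

   If 1 lies in the initial ideal for (L, t), then lifting it and translating back
   gives an L-linear combination of elements of the ideal of X with the above
   property. Gaussian elimination with pivots of maximal absolute value turns it
   into one with coefficients in K, without completing K.

   The same minimal seminorms provide a point (L, t) above omega, when X = T, and
   prime ideals containing a proper ideal, from its indicator seminorm. *)

Set Implicit Arguments.
Unset Strict Implicit.
Unset Printing Implicit Defensive.

Import Order.TTheory GRing.Theory Num.Theory.

Local Open Scope classical_set_scope.
Local Open Scope ring_scope.

(** * Real inequalities on the growth of powers *)

Section Bernoulli.
Context (R : realType).
Implicit Types (c r : R).

Lemma bernoulli_ineq r n : 0 <= r -> 1 + n%:R * r <= (1 + r) ^+ n.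
Proof.
move=> r0; elim: n => [|n IH]; first by rewrite mul0r addr0 expr0.
have nr0 : 0 <= n%:R * r * r by rewrite !mulr_ge0.
rewrite (le_trans (_ : _ <= (1 + r) * (1 + n%:R * r))) //.
  by rewrite -natr1; lra.
by rewrite exprS ler_wpM2l // addr_ge0.
Qed.

(** If [r] = 1 + e with e > 0, the squared Bernoulli inequality makes the 2n-th power of [r] at
    least quadratic in n, which beats any linear bound. This absorbs the number of terms in binomial
    expansions. *)
Lemma le1_of_expr_bounded c r : (forall n, r ^+ n <= c * n.+1%:R) -> r <= 1.
Proof.
move=> h; rewrite leNgt; apply/negP => r1; pose e := r - 1.
have e0 : 0 < e by rewrite subr_gt0.
have c1 : 1 <= c by have := h 0%N; rewrite expr0 mulr1.
have bnd n : n%:R * e ^+ 2 <= 3 * c.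
  case: n => [|n]; first by rewrite mul0r; lra.
  have /= := bernoulli_ineq n.+1 (ltW e0); rewrite (_ : 1 + e = r) ?subrKC //.
  move=> le1; have le2 := h (n.+1 * 2)%N; move: le2; rewrite exprM => le2.
  have n0 : 0 < n.+1%:R :> R by rewrite ltr0n.
  have le3 : (1 + n.+1%:R * e) ^+ 2 <= c * (n.+1 * 2).+1%:R.
    by rewrite (le_trans _ le2) // lerXn2r ?nnegrE // ?exprn_ge0 ?addr_ge0 ?mulr_ge0; lra.
  have n1 : 1 <= n.+1%:R :> R by rewrite ler1n.
  rewrite -(ler_pM2l n0) (le_trans (_ : _ <= (1 + n.+1%:R * e) ^+ 2)) //.
    have : 0 <= n.+1%:R * e by rewrite mulr_ge0 ?ltW.
    by rewrite (_ : n.+1%:R * (n.+1%:R * e ^+ 2) = (n.+1%:R * e) ^+ 2); [nra|ring].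
  rewrite (le_trans le3) // -[(n.+1 * 2).+1%:R]natr1 natrM.
  have : 0 <= c * (n.+1%:R - 1) by rewrite mulr_ge0 ?subr_ge0 //; lra.
  by set m : R := n.+1%:R; lra.
have e2 : 0 < e ^+ 2 by rewrite exprn_gt0.
have : 0 <= 3 * c / e ^+ 2 by rewrite divr_ge0 ?ltW //; lra.
move=> /archi_boundP; rewrite ltr_pdivrMr // => lt.
by have := lt_le_trans lt (bnd _); rewrite ltxx.
Qed.

(** [r] is the n-th root of [a], or [c / 2] if that is larger, which keeps [r] positive when [a] =
    0. *)
Lemma expr_lt_interpolate a c n : (0 < n)%N -> 0 <= a -> 0 < c -> a < c ^+ n ->
  exists r, [/\ 0 < r, r < c & a <= r ^+ n].
Proof.
move=> n0 a0 c0 ac; pose t := a `^ n%:R^-1.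
have tn : t ^+ n = a.
  by rewrite -powR_mulrn ?powR_ge0 // -powRrM mulVf ?powRr1 // pnatr_eq0 -lt0n.
have t0 : 0 <= t by exact: powR_ge0.
exists (Num.max (c / 2) t); split; first by rewrite lt_max divr_gt0.
  rewrite gt_max ltr_pdivrMr // ltr_pMr // ltr1n /=.
  by rewrite -(ltr_pXn2r n0) ?nnegrE ?(ltW c0) ?tn ?ac ?andbT //; lra.
by rewrite -{1}tn lerXn2r ?nnegrE ?le_max ?lexx ?t0 ?orbT.
Qed.

End Bernoulli.

(** * Non-archimedean seminorms: spectral radius, localization, minimality *)

Section Seminorms.
Context (R : realType) (A : comNzRingType).
Implicit Types (p q : A -> R) (x y z : A) (c d r s : R).

Record seminorm_ring p : Prop := SeminormRing {
  seminorm_ge0 : forall x, 0 <= p x;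
  seminorm0 : p 0 = 0;
  seminorm1 : p 1 = 1;
  seminormD : forall x y, p (x + y) <= Num.max (p x) (p y);
  seminormM : forall x y, p (x * y) <= p x * p y }.

(* [B x c] reads: the size of x is at most c. *)
Record gauge (B : A -> set R) : Prop := Gauge {
  gauge_ge0 : forall x c, B x c -> 0 <= c;
  gauge_bounded : forall x, B x !=set0;
  gauge0 : B 0 0;
  gauge1 : B 1 1;
  gauge1_ge : forall c, B 1 c -> 1 <= c;
  gaugeD : forall x y c d, B x c -> B y d -> B (x + y) (Num.max c d);
  gaugeM : forall x y c d, B x c -> B y d -> B (x * y) (c * d) }.

Section GaugeSeminorm.
Variables (B : A -> set R) (gB : gauge B).

Lemma gauge_inf_le x c : B x c -> inf (B x) <= c.
Proof.
by move=> Bc; apply: ge_inf => //; exists 0 => d /(gauge_ge0 gB).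
Qed.

Lemma gauge_inf_ge x d : (forall c, B x c -> d <= c) -> d <= inf (B x).
Proof. by move=> h; apply: lb_le_inf => //; exact: gauge_bounded. Qed.

Lemma gauge_inf_lt x d : inf (B x) < d -> exists2 c, B x c & c < d.
Proof.
move=> lt; apply: contrapT => h; move: lt; apply/negP; rewrite -leNgt.
by apply: gauge_inf_ge => c Bc; rewrite leNgt; apply/negP => cd; apply: h; exists c.
Qed.

(** For products one infimum is taken at a time, first over the bounds of [x] with [d] fixed. Zero
    values are set apart because the argument divides. *)
Lemma gauge_seminorm : seminorm_ring (fun x => inf (B x)).
Proof.
have ge0 x : 0 <= inf (B x) by apply: gauge_inf_ge => c /(gauge_ge0 gB).
split=> //.
- by apply/le_anti; rewrite ge0 gauge_inf_le //; exact: gauge0.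
- apply/le_anti; rewrite gauge_inf_le ?gauge_inf_ge //; first exact: gauge1_ge.
  exact: gauge1.
- move=> x y; rewrite leNgt; apply/negP; rewrite gt_max => /andP[].
  move=> /gauge_inf_lt[c Bc cl] /gauge_inf_lt[d Bd dl].
  have := gauge_inf_le (gaugeD gB Bc Bd).
  by rewrite leNgt gt_max cl dl.
move=> x y.
have le1 d : B y d -> inf (B (x * y)) <= inf (B x) * d.
  move=> Bd; have [d0|d0] := eqVneq d 0.
    have [c Bc] := gauge_bounded gB x.
    by have := gauge_inf_le (gaugeM gB Bc Bd); rewrite d0 !mulr0.
  have dgt0 : 0 < d by rewrite lt_neqAle eq_sym d0 (gauge_ge0 gB Bd).
  rewrite -ler_pdivrMr //; apply: gauge_inf_ge => c Bc.
  rewrite ler_pdivrMr //; apply: gauge_inf_le; exact: gaugeM.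
have [x0|x0] := eqVneq (inf (B x)) 0.
  by have [d /le1] := gauge_bounded gB y; rewrite x0 !mul0r.
have xgt0 : 0 < inf (B x) by rewrite lt_neqAle eq_sym x0 ge0.
rewrite [leRHS]mulrC -ler_pdivrMr //; apply: gauge_inf_ge => d Bd.
by rewrite ler_pdivrMr // [leRHS]mulrC; exact: le1.
Qed.

End GaugeSeminorm.

Section SeminormTheory.
Variables (p : A -> R) (sp : seminorm_ring p).

Let p_ge0 := seminorm_ge0 sp.

Lemma seminormX x n : p (x ^+ n) <= p x ^+ n.
Proof.
elim: n => [|n IH]; first by rewrite !expr0 (seminorm1 sp).
by rewrite !exprS (le_trans (seminormM sp _ _)) // ler_wpM2l.
Qed.

Lemma seminormMn x n : p (x *+ n) <= p x.
Proof.
elim: n => [|n IH]; first by rewrite mulr0n (seminorm0 sp).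
by rewrite mulrS (le_trans (seminormD sp _ _)) // ge_max lexx.
Qed.

Lemma seminorm_sum_le (I : Type) (r : seq I) (F : I -> A) c :
  0 <= c -> (forall i, p (F i) <= c) -> p (\sum_(i <- r) F i) <= c.
Proof.
move=> c0 Fc; elim: r => [|i r IH]; first by rewrite big_nil (seminorm0 sp).
by rewrite big_cons (le_trans (seminormD sp _ _)) // ge_max Fc.
Qed.

Lemma seminorm_powD x y c d r s n :
  0 <= r -> 0 <= s ->
  (forall m, p (x ^+ m) <= c * r ^+ m) -> (forall m, p (y ^+ m) <= d * s ^+ m) ->
  p ((x + y) ^+ n) <= c * d * Num.max r s ^+ n.
Proof.
move=> r0 s0 xc yd; set t := Num.max r s.
have t0 : 0 <= t by rewrite le_max r0.
have c0 : 0 <= c by have := xc 0%N; rewrite !expr0 mulr1; exact: le_trans.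
have d0 : 0 <= d by have := yd 0%N; rewrite !expr0 mulr1; exact: le_trans.
rewrite exprDn; apply: seminorm_sum_le => [|i].
  by rewrite !mulr_ge0 ?exprn_ge0.
rewrite (le_trans (seminormMn _ _)) // (le_trans (seminormM sp _ _)) //.
have -> : t ^+ n = t ^+ (n - i) * t ^+ i by rewrite -exprD subnK // leq_ord.
rewrite mulrACA ler_pM //.
  by rewrite (le_trans (xc _)) // ler_wpM2l // lerXn2r ?nnegrE // le_max lexx.
by rewrite (le_trans (yd _)) // ler_wpM2l // lerXn2r ?nnegrE // le_max lexx orbT.
Qed.

(** The infimum of these [r] is the spectral radius of [x], the limit of the n-th roots of
    [p (x ^+ n)]. *)
Definition spectral_bound x r : Prop :=
  0 <= r /\ exists c, forall n, p (x ^+ n) <= c * r ^+ n.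

Lemma spectral_gauge : gauge spectral_bound.
Proof.
split.
- by move=> x c [].
- move=> x; exists (p x); split=> //; exists 1 => n.
  by rewrite mul1r; exact: seminormX.
- split=> //; exists 1 => -[|n]; first by rewrite !expr0 (seminorm1 sp) mulr1.
  by rewrite !exprS !mul0r mulr0 (seminorm0 sp).
- by split=> //; exists 1 => n; rewrite !expr1n (seminorm1 sp) mulr1.
- move=> r [r0 [c h]]; rewrite leNgt; apply/negP => r1.
  have rgt0 : 0 < r.
    rewrite lt_neqAle r0 andbT; apply/eqP => r_0; have := h 1%N.
    by rewrite -r_0 !expr1 mulr0 (seminorm1 sp) ler10.
  (* As 1 <= [c * r ^+ n] for all [n], the powers of the inverse of [r] are bounded by [c]. *)
  have : r^-1 <= 1.
    apply: (@le1_of_expr_bounded _ c) => n; have := h n.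
    rewrite expr1n (seminorm1 sp) exprVn -ler_pdivrMr ?exprn_gt0 // mul1r.
    move=> le; rewrite (le_trans le) // ler_peMr ?ler1n //.
    by apply: le_trans le; rewrite invr_ge0 exprn_ge0.
  by rewrite invf_le1 // leNgt r1.
- move=> x y r s [r0 [c xc]] [s0 [d yd]]; split; first by rewrite le_max r0.
  by exists (c * d) => n; exact: seminorm_powD.
move=> x y r s [r0 [c xc]] [s0 [d yd]]; split; first exact: mulr_ge0.
exists (c * d) => n; rewrite !exprMn (le_trans (seminormM sp _ _)) //.
by rewrite mulrACA ler_pM.
Qed.

(* Localizing [p] at [y]: the size of [x] is [lim p (x y^n) / p(y)^n]. *)
Definition localized_bound y x r : Prop :=
  0 <= r /\ exists n, p (x * y ^+ n) <= r * p y ^+ n.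

(** An exponent that works can be enlarged, so two elements may share a common one. *)
Lemma localized_boundW y x r n : 0 <= r -> p (x * y ^+ n) <= r * p y ^+ n ->
  forall m, p (x * y ^+ (n + m)) <= r * p y ^+ (n + m).
Proof.
move=> r0 h m; rewrite !exprD !mulrA (le_trans (seminormM sp _ _)) //.
by rewrite ler_pM // seminormX.
Qed.

(** Power-multiplicativity at [y] keeps the size of 1 at least 1 after localizing. *)
Lemma localized_gauge y : (forall n, p (y ^+ n) = p y ^+ n) -> 0 < p y ->
  gauge (localized_bound y).
Proof.
move=> yX y0; split.
- by move=> x c [].
- by move=> x; exists (p x); split=> //; exists 0%N; rewrite !expr0 !mulr1.
- by split=> //; exists 0%N; rewrite mul0r (seminorm0 sp) mul0r.
- by split=> //; exists 0%N; rewrite mul1r (seminorm1 sp) mul1r.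
- move=> c [c0 [n]]; rewrite mul1r yX -{1}(mul1r (p y ^+ n)) ler_pM2r //.
  exact: exprn_gt0.
- move=> x z c d [c0 [n xc]] [d0 [m zd]]; split; first by rewrite le_max c0.
  exists (n + m)%N; rewrite mulrDl (le_trans (seminormD sp _ _)) // ge_max.
  rewrite (le_trans (localized_boundW c0 xc m)) /=; last first.
    by rewrite ler_wpM2r ?exprn_ge0 // le_max lexx.
  rewrite addnC (le_trans (localized_boundW d0 zd n)) //.
  by rewrite ler_wpM2r ?exprn_ge0 // le_max lexx orbT.
move=> x z c d [c0 [n xc]] [d0 [m zd]]; split; first exact: mulr_ge0.
exists (n + m)%N; rewrite !exprD mulrACA (le_trans (seminormM sp _ _)) //.
by rewrite mulrACA ler_pM.
Qed.

End SeminormTheory.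

Section MinimalSeminorm.
Variables (p : A -> R) (sp : seminorm_ring p).
Hypothesis p_min : forall q, seminorm_ring q -> (forall x, q x <= p x) -> q = p.

Let p_ge0 := seminorm_ge0 sp.

Lemma minimal_seminorm_le B x c : gauge B -> (forall z, B z (p z)) ->
  B x c -> p x <= c.
Proof.
move=> gB pB /(gauge_inf_le gB); suff -> : p = (fun z => inf (B z)) by [].
by apply/esym/p_min => [|z]; [exact: gauge_seminorm|exact: gauge_inf_le].
Qed.

(** If [p (y ^+ k.+1)] were too small, it would still be at most [r ^+ k.+1] for some [r] < [p y].
    Such an [r] is a spectral bound of [y], against minimality. *)
Lemma minimal_seminormX y n : p (y ^+ n) = p y ^+ n.
Proof.
case: n => [|k]; first by rewrite !expr0 (seminorm1 sp).
apply/le_anti; rewrite seminormX //= leNgt; apply/negP => lt.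
have y0 : 0 < p y.
  rewrite lt_neqAle p_ge0 andbT eq_sym; apply: contraTneq lt => ->.
  by rewrite expr0n /= -leNgt.
have [r [r0 ry le]] := expr_lt_interpolate (ltn0Sn k) (p_ge0 _) y0 lt.
suff : p y <= r by rewrite leNgt ry.
apply: (minimal_seminorm_le (spectral_gauge sp)).
  by move=> z; split=> //; exists 1 => n; rewrite mul1r seminormX.
split; first exact: ltW.
(* When [n] is divided by [k.+1], the quotient part is bounded by a power of [r], and this constant
   pays for the remainder, which is less than [k.+1]. *)
exists ((p y / r) ^+ k.+1) => n.
have pyr : 1 <= p y / r by rewrite ler_pdivlMr // mul1r ltW.
rewrite (divn_eq n k.+1) !exprD mulnC 2!(exprM _ k.+1).
rewrite (le_trans (seminormM sp _ _)) // mulrCA ler_pM //.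
  rewrite (le_trans (seminormX sp _ _)) // lerXn2r ?nnegrE ?exprn_ge0 //.
  exact: ltW.
rewrite (le_trans (seminormX sp _ _)) //.
have -> : p y ^+ (n %% k.+1) = (p y / r) ^+ (n %% k.+1) * r ^+ (n %% k.+1).
  by rewrite -exprMn divfK ?gt_eqF.
rewrite ler_pM2r ?exprn_gt0 // ler_weXn2l //.
by rewrite ltnW // ltn_mod.
Qed.

(** In the localization at [y] the size of [x] is at most [p (x * y) / p y], by exponent 1;
    minimality carries this bound over to [p]. *)
Lemma minimal_seminormM : {morph p : x y / x * y}.
Proof.
move=> x y; have [y0|y0] := eqVneq (p y) 0.
  apply/le_anti; rewrite seminormM //= y0 mulr0 p_ge0 //.
have yX n := minimal_seminormX y n.
have ygt0 : 0 < p y by rewrite lt_neqAle eq_sym y0 p_ge0.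
apply/le_anti; rewrite seminormM //= -ler_pdivlMr //.
apply: (minimal_seminorm_le (localized_gauge sp yX ygt0)).
  by move=> z; split=> //; exists 0%N; rewrite !expr0 !mulr1.
split; first by rewrite divr_ge0.
by exists 1%N; rewrite !expr1 divfK.
Qed.

End MinimalSeminorm.

(** Zorn's lemma gives a minimal seminorm below [q]. The infimum over a chain is a seminorm because
    any two members lie above one of them. *)
Lemma bounded_multiplicative_seminorm q : seminorm_ring q ->
  exists p, [/\ seminorm_ring p, {morph p : x y / x * y} & forall x, p x <= q x].
Proof.
move=> sq; pose T := {p : A -> R | seminorm_ring p /\ forall x, p x <= q x}.
(* The order is reversed, so that a maximal element is a minimal seminorm. *)
pose ge (p1 p2 : T) : bool := `[< forall x, sval p2 x <= sval p1 x >].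
have [|||C totC|[p [sp pq]] pmax] := @Zorn T ge.
- by move=> t; apply/asboolP.
- move=> t1 t2 t3 /asboolP h1 /asboolP h2; apply/asboolP => x.
  exact: le_trans (h1 x).
- move=> [p1 h1] [p2 h2] /asboolP /= le1 /asboolP /= le2.
  have e : p1 = p2 by apply/funext => x; apply/le_anti; rewrite le1 le2.
  by move: h1 h2 le1 le2; rewrite e => h1 h2 _ _; congr exist; exact: Prop_irrelevance.
(* [q] itself joins the chain, so that the infimum makes sense even for the empty chain. *)
- pose q' : T := exist _ q (conj sq (fun x => lexx _)).
  pose B x : set R := [set c | exists2 t : T, C t \/ t = q' & sval t x <= c].
  have tot (t1 t2 : T) : C t1 \/ t1 = q' -> C t2 \/ t2 = q' ->
      exists t, [/\ C t \/ t = q', ge t1 t & ge t2 t].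
    move=> C1 C2; suff [h|h] : ge t1 t2 \/ ge t2 t1.
    + by exists t2; split=> //; apply/asboolP.
    + by exists t1; split=> //; apply/asboolP.
    case: C1 C2 => [C1|->] [C2|->].
    + exact: totC.
    + by right; apply/asboolP; case: (t1) => ? [].
    + by left; apply/asboolP; case: (t2) => ? [].
    + by left; apply/asboolP.
  have sT (t : T) : seminorm_ring (sval t) by case: t => ? [].
  have gB : gauge B.
    split.
    + by move=> x c [t _]; apply: le_trans; exact: seminorm_ge0.
    + by move=> x; exists (q x); exists q'; [right|].
    + by exists q'; [right|rewrite seminorm0].
    + by exists q'; [right|rewrite seminorm1].
    + by move=> c [t _]; rewrite seminorm1.
    + move=> x y c d [t1 C1 xc] [t2 C2 yd].
      have [t [Ct /asboolP h1 /asboolP h2]] := tot _ _ C1 C2.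
      exists t => //; rewrite (le_trans (seminormD (sT t) _ _)) //.
      by rewrite ge_max !le_max (le_trans (h1 x) xc) (le_trans (h2 y) yd) orbT.
    move=> x y c d [t1 C1 xc] [t2 C2 yd].
    have [t [Ct /asboolP h1 /asboolP h2]] := tot _ _ C1 C2.
    exists t => //; rewrite (le_trans (seminormM (sT t) _ _)) //.
    by rewrite ler_pM ?(le_trans (h1 x) xc) ?(le_trans (h2 y) yd) //; exact: seminorm_ge0.
  have Bq x : inf (B x) <= q x by apply: gauge_inf_le => //; exists q'; [right|].
  exists (exist _ (fun x => inf (B x)) (conj (gauge_seminorm gB) Bq)) => t Ct.
  by apply/asboolP => x /=; apply: gauge_inf_le => //; exists t; [left|].
exists p; split=> //; apply: minimal_seminormM => // p' sp' p'p.
have p'q x : p' x <= q x by exact: le_trans (pq x).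
pose t : T := exist _ p' (conj sp' p'q).
have /pmax e : ge (exist _ p (conj sp pq)) t by exact/asboolP.
by have := congr1 sval e.
Qed.

End Seminorms.

(** * From a multiplicative seminorm to a valued field *)

Section FractionAbsval.
Context (R : realType) (Q : idomainType) (p : Q -> R).
Hypothesis p_ge0 : forall x, 0 <= p x.
Hypothesis p_eq0 : forall x, (p x == 0) = (x == 0).
Hypothesis pM : {morph p : x y / x * y}.
Hypothesis p_ultra : forall x y, p (x + y) <= Num.max (p x) (p y).

Local Notation "x %:F" := (@FracField.tofrac Q x).

Lemma fraction_numden (x : {fraction Q}) :
  exists nd : Q * Q, nd.2 != 0 /\ x * nd.2%:F = nd.1%:F.
Proof.
elim/quotW: x => r; exists (frac r); split; first exact: denom_ratioP.
unlock FracField.tofrac; rewrite -[LHS]FracField.pi_mul.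
apply/eqmodP; rewrite /= FracField.equivfE /FracField.mulf.
by rewrite !numden_Ratio ?mulr1 ?oner_neq0 ?denom_ratioP //= mulrC.
Qed.

Let nd x : Q * Q := sval (cid (fraction_numden x)).
Let num x := (nd x).1.
Let den x := (nd x).2.

Let den_neq0 x : den x != 0. Proof. by rewrite /den /nd; case: cid => ? []. Qed.
Let num_den x : x * (den x)%:F = (num x)%:F.
Proof. by rewrite /num /den /nd; case: cid => ? []. Qed.

Let abs x : R := p (num x) / p (den x).

(** The value is the same for every fraction representing [x], so a common denominator may be used
    for sums. *)
Let absE x n d : d != 0 -> x * d%:F = n%:F -> abs x = p n / p d.
Proof.
move=> d0 xd; apply/eqP; rewrite /abs eqr_div ?p_eq0 // -!pM.
apply/eqP; congr p; apply/eqP; rewrite -tofrac_eq !tofracM -num_den -xd.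
by apply/eqP; ring.
Qed.

Let abs_ge0 x : 0 <= abs x. Proof. by rewrite divr_ge0. Qed.

Let abs_eq0 x : (abs x == 0) = (x == 0).
Proof.
rewrite /abs mulf_eq0 invr_eq0 !p_eq0 (negbTE (den_neq0 x)) orbF -tofrac_eq0 -num_den.
by rewrite mulf_eq0 tofrac_eq0 (negbTE (den_neq0 x)) orbF.
Qed.

Let absM x y : abs (x * y) = abs x * abs y.
Proof.
rewrite (@absE _ (num x * num y) (den x * den y)) ?mulf_neq0 //.
  by rewrite !pM /abs mulf_div.
by rewrite !tofracM -!num_den; ring.
Qed.

Let abs_ultra x y : abs (x + y) <= Num.max (abs x) (abs y).
Proof.
have p_gt0 z : z != 0 -> 0 < p z.
  by move=> z0; rewrite lt_neqAle p_ge0 eq_sym p_eq0 z0.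
rewrite (@absE _ (num x * den y + num y * den x) (den x * den y)) ?mulf_neq0 //;
  last by rewrite tofracD !tofracM -!num_den; ring.
rewrite (@absE x (num x * den y) (den x * den y)) ?mulf_neq0 //;
  last by rewrite !tofracM -!num_den; ring.
rewrite (@absE y (num y * den x) (den x * den y)) ?mulf_neq0 //;
  last by rewrite !tofracM -!num_den; ring.
by rewrite -maxr_pMl ?invr_ge0 // ler_pM2r ?invr_gt0 ?p_gt0 ?mulf_neq0.
Qed.

Lemma fraction_absval : exists w : absval R {fraction Q}, forall x, w x%:F = p x.
Proof.
exists (AbsVal abs_ge0 abs_eq0 absM abs_ultra) => x /=.
have p1 : p 1 = 1.
  have p1 : p 1 != 0 by rewrite p_eq0 oner_neq0.
  by apply: (mulfI p1); rewrite -pM !mulr1.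
by rewrite (@absE _ x 1) ?oner_neq0 ?rmorph1 ?mulr1 // p1 divr1.
Qed.

End FractionAbsval.

Section ClassicalUnits.
Context (A : comNzRingType).

Definition classical_unit : pred A := fun x => `[< exists y, y * x = 1 >].

Definition classical_inv (x : A) : A :=
  if pselect (exists y, y * x = 1) is left h then sval (cid h) else x.

Lemma classical_mulVr : {in classical_unit, left_inverse 1 classical_inv *%R}.
Proof.
move=> x /asboolP ux; rewrite /classical_inv; case: pselect => // h.
by case: cid.
Qed.

Lemma classical_unitPl x y : y * x = 1 -> classical_unit x.
Proof. by move=> yx; apply/asboolP; exists y. Qed.

Lemma classical_invr_out : {in [predC classical_unit], classical_inv =1 id}.
Proof.
by move=> x /asboolP ux; rewrite /classical_inv; case: pselect.
Qed.

End ClassicalUnits.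

Section SeminormValuedField.
Context (R : realType) (A : comNzRingType) (p : A -> R).
Hypotheses (sp : seminorm_ring p) (pM : {morph p : x y / x * y}).

Lemma mult_seminormN x : p (- x) = p x.
Proof.
have pN1 : p (-1) = 1.
  apply/eqP; rewrite -(@eqrXn2 _ 2) ?(seminorm_ge0 sp) ?ler01 //.
  by rewrite expr1n expr2 -pM mulrNN mulr1 (seminorm1 sp).
by rewrite -mulN1r pM pN1 mul1r.
Qed.

(** This makes [p] descend to the quotient by its kernel, or by any ideal on which it vanishes. *)
Lemma mult_seminorm_eq x y : p (x - y) = 0 -> p x = p y.
Proof.
have le a b : p (a - b) = 0 -> p a <= p b.
  move=> ab; rewrite -(subrK b a) (le_trans (seminormD sp _ _)) //.
  by rewrite ab ge_max lexx seminorm_ge0.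
by move=> xy; apply/le_anti; rewrite !le // -mult_seminormN opprB.
Qed.

Definition seminorm_ker : {pred A} := [pred x | p x == 0].

Let ker_idealr : idealr_closed seminorm_ker.
Proof.
split=> [||a x y]; rewrite !inE ?(seminorm0 sp) ?(seminorm1 sp) //.
  exact: oner_neq0.
move=> /eqP x0 /eqP y0; rewrite eq_le seminorm_ge0 // andbT.
by rewrite (le_trans (seminormD sp _ _)) // pM x0 y0 mulr0 maxxx.
Qed.

Let ker_prime : prime_idealr_closed seminorm_ker.
Proof. by move=> x y; rewrite !inE pM mulf_eq0. Qed.

HB.instance Definition _ := isIdealr.Build A seminorm_ker ker_idealr.
HB.instance Definition _ := isPrimeIdealrClosed.Build A seminorm_ker ker_prime.

Definition ker_quot : Type := {ideal_quot seminorm_ker}.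
HB.instance Definition _ := GRing.ComNzRing.on ker_quot.
HB.instance Definition _ := GRing.ComNzRing_hasMulInverse.Build ker_quot
  (@classical_mulVr ker_quot) (@classical_unitPl ker_quot)
  (@classical_invr_out ker_quot).
HB.instance Definition _ := GRing.ComUnitRing_isIntegral.Build ker_quot
  (@Quotient.rquot_IdomainAxiom A seminorm_ker).

Let pi : A -> ker_quot := (\pi_({ideal_quot seminorm_ker}))%qT.
Let pi_zmod : zmod_morphism pi. Proof. exact: pi_is_zmod_morphism. Qed.
Let pi_monoid : monoid_morphism pi. Proof. exact: pi_is_monoid_morphism. Qed.
HB.instance Definition _ := GRing.isZmodMorphism.Build A ker_quot pi pi_zmod.
HB.instance Definition _ := GRing.isMonoidMorphism.Build A ker_quot pi pi_monoid.

Let pbar (q : ker_quot) : R := p (repr (q : {ideal_quot seminorm_ker})).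

Let pi_repr q : pi (repr (q : {ideal_quot seminorm_ker})) = q.
Proof. exact: reprK. Qed.

Let pbar_pi a : pbar (pi a) = p a.
Proof.
apply: mult_seminorm_eq; apply/eqP.
rewrite -[_ == 0]/(_ \in seminorm_ker) Quotient.idealrBE.
by rewrite -[_ == _]/(pi _ == pi _) pi_repr.
Qed.

(** [L] is the fraction field of [A] modulo the kernel of [p]: the residue field of a Berkovich
    point before completion. *)
Lemma seminorm_valued_field : exists (L : fieldType) (w : absval R L)
  (j : {rmorphism A -> L}), forall a, w (j a) = p a.
Proof.
have [|||| w wE] := @fraction_absval R ker_quot pbar.
- by move=> q; exact: (seminorm_ge0 sp).
- move=> q; rewrite -{2}(pi_repr q) -(rmorph0 pi).
  rewrite -[_ == pi 0 in RHS]Quotient.idealrBE subr0 //.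
- by move=> x y; rewrite -(pi_repr x) -(pi_repr y) -rmorphM !pbar_pi pM.
- by move=> x y; rewrite -(pi_repr x) -(pi_repr y) -rmorphD !pbar_pi (seminormD sp).
exists {fraction ker_quot}, w, (@FracField.tofrac ker_quot \o pi) => a.
by rewrite /= wE pbar_pi.
Qed.

End SeminormValuedField.

(** * Prime ideals containing a proper ideal *)

Section IdealPoints.
Context (A : comNzRingType) (I : ideal A).

(* Any multiplicative seminorm that is at most 1 and vanishes on [I] has a
   prime kernel containing [I]; start from the indicator of the complement. *)
Lemma points_neq0 (R : realType) : points I !=set0 <-> ~ ideal_set I 1.
Proof.
split=> [[P [[P1 _] IP]] /IP//|I1].
pose B (x : A) : set R := [set c | 0 <= c /\ (ideal_set I x \/ 1 <= c)].
have gB : gauge B.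
  split.
  - by move=> x c [].
  - by move=> x; exists 1; split=> //; right.
  - by split=> //; left; exact: ideal0.
  - by split=> //; right.
  - by move=> c [_ []].
  - move=> x y c d [c0 xc] [d0 yd]; split; first by rewrite le_max c0.
    case: xc yd => [xI|c1] [yI|d1]; rewrite ?le_max ?c1 ?d1 ?orbT; try by right.
    by left; exact: idealD.
  move=> x y c d [c0 xc] [d0 yd]; split; first exact: mulr_ge0.
  case: xc yd => [xI|c1]; first by left; rewrite mulrC; exact: idealM.
  by case=> [yI|d1]; [left; exact: idealM|right; exact: mulr_ege1].
have [p [sp pM pB]] := bounded_multiplicative_seminorm (gauge_seminorm gB).
have p0 := seminorm0 sp; have pge0 := seminorm_ge0 sp.
have kerD x y : p x = 0 -> p y = 0 -> p (x + y) = 0.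
  move=> x0 y0; apply/le_anti; rewrite pge0 andbT.
  by rewrite (le_trans (seminormD sp _ _)) // x0 y0 maxxx.
have kerM a x : p x = 0 -> p (a * x) = 0 by move=> x0; rewrite pM x0 mulr0.
exists (@Ideal A [set x | p x = 0] p0 kerD kerM); split; first split=> /=.
- by rewrite (seminorm1 sp) => /eqP; rewrite oner_eq0.
- by move=> x y /eqP; rewrite pM mulf_eq0 => /orP[]/eqP; [left|right].
move=> x Ix; apply/le_anti; rewrite pge0 andbT (le_trans (pB x)) //.
by apply: (gauge_inf_le gB); split=> //; left.
Qed.

End IdealPoints.

(** * Auxiliary facts on coefficients in the group algebra *)

Lemma additive_ext (U V : nmodType) (f g : {additive U -> V}) : f =1 g -> f = g.
Proof.
case: f g => f [[cf]] [g [[cg]]] /= /funext fg; move: cf cg; rewrite fg => cf cg.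
by rewrite (Prop_irrelevance cf cg).
Qed.

Lemma absv0 (R : realType) (K : fieldType) (v : absval R K) : v 0 = 0.
Proof. by apply/eqP; rewrite absv_eq0. Qed.

Lemma absv_sum_le (R : realType) (K : fieldType) (v : absval R K) (I : Type)
    (s : seq I) (F : I -> K) (c : R) :
  0 <= c -> (forall i, v (F i) <= c) -> v (\sum_(i <- s) F i) <= c.
Proof.
move=> c0 Fc; elim: s => [|i s IH].
  by rewrite big_nil absv0.
by rewrite big_cons (le_trans (absv_ultra _ _ _)) // ge_max Fc.
Qed.

Lemma ga_coef0 (A : comNzRingType) (M : zmodType) (u : M) :
  ga_coef u (0 : grpalg A M) = 0.
Proof. exact: (raddf0 (mcoeff u)). Qed.

Lemma ga_coef1 (A : comNzRingType) (M : zmodType) (u : M) :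
  ga_coef u (1 : grpalg A M) = (0 == u)%:R.
Proof. by rewrite -chi0 ga_coef_monom. Qed.

Lemma ga_coefB (A : comNzRingType) (M : zmodType) (u : M) (f g : grpalg A M) :
  ga_coef u (f - g) = ga_coef u f - ga_coef u g.
Proof. exact: (raddfB (mcoeff u)). Qed.

Lemma ga_coef_sum (A : comNzRingType) (M : zmodType) (u : M) (I : Type)
    (s : seq I) (F : I -> grpalg A M) :
  ga_coef u (\sum_(i <- s) F i) = \sum_(i <- s) ga_coef u (F i).
Proof. exact: (raddf_sum (mcoeff u)). Qed.

Lemma ga_coef_map (A B : comNzRingType) (M : zmodType) (phi : {rmorphism A -> B})
    (u : M) (f : grpalg A M) : ga_coef u (ga_map phi f) = phi (ga_coef u f).
Proof. by rewrite ga_morE mulr1. Qed.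

(** Coefficients are lifted one by one over the support of [g] only, which keeps the lift finitely
    supported. *)
Lemma ga_mor_lift (A B : comNzRingType) (M : zmodType) (phi : {rmorphism A -> B})
    (t : M -> B) (g : grpalg B M) :
  (forall u, exists a, phi a * t u = ga_coef u g) ->
  exists f, ga_mor phi t f = g.
Proof.
move=> /choice[l lE]; exists (\sum_(u <- ga_supp g) ga_monom (l u) u).
apply: ga_coefP => u; rewrite ga_morE ga_coef_sum.
have [ug|ug] := boolP (u \in ga_supp g).
  rewrite (big_fsetD1 u) //= ga_coef_monom eqxx big1_fset ?addr0 ?mulr1n ?lE // => v.
  by rewrite in_fsetD1 ga_coef_monom; case: eqP.
rewrite big1_fset ?rmorph0 ?mul0r ?ga_coef_outsupp // => v vg _.
by rewrite ga_coef_monom; case: eqP ug => // <-; rewrite vg.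
Qed.

Lemma ga_scalarE (A : comNzRingType) (M : zmodType) (c : A) :
  c%:A = ga_monom c 0 :> grpalg A M.
Proof.
by apply: ga_coefP => u; rewrite ga_coefZ ga_coef1 ga_coef_monom mulr_natr.
Qed.

Lemma seq_argmax (R : realType) (T : eqType) (s : seq T) (F : T -> R) x0 :
  x0 \in s -> exists2 x, x \in s & forall y, y \in s -> F y <= F x.
Proof.
elim: s x0 => // a [|b s] IH x0 _.
  by exists a; rewrite ?mem_head // => y; rewrite inE => /eqP->.
have [x xs xmax] := IH b (mem_head _ _).
have [le|lt] := leP (F a) (F x).
  exists x; first by rewrite inE xs orbT.
  by move=> y; rewrite inE => /orP[/eqP->//|/xmax].
exists a; first exact: mem_head.
move=> y; rewrite inE => /orP[/eqP->//|/xmax le].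
exact: le_trans (ltW lt).
Qed.

(** * Weighted Gauss norms and their quotients *)

Section Smallness.
Context (R : realType) (M : zmodType) (omega : {additive M -> R}).

(* All terms of [f] have absolute value less than 1 at the points of
   tropicalization [omega]. *)
Definition small (L : fieldType) (w : absval R L) (f : grpalg L M) : Prop :=
  forall u, w (ga_coef u f) < expR (omega u).

Section GaussNorm.
Context (K : fieldType) (v : absval R K).
Implicit Types (f g : grpalg K M) (c d : R).

(** Equivalently, [c] bounds the Gauss norm of weight [omega], the maximum of
    [v (ga_coef u f) * expR (- omega u)]. *)
Definition gauss_le f c : Prop :=
  forall u, v (ga_coef u f) <= c * expR (omega u).

Lemma gauss_leD f g c d :
  gauss_le f c -> gauss_le g d -> gauss_le (f + g) (Num.max c d).
Proof.
move=> fc gd u; rewrite ga_coefD (le_trans (absv_ultra _ _ _)) // ge_max.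
rewrite (le_trans (fc u)) ?(le_trans (gd u)) // ler_wpM2r ?expR_ge0 //.
  by rewrite le_max lexx orbT.
by rewrite le_max lexx.
Qed.

Lemma gauss_leM f g c d : 0 <= c -> 0 <= d ->
  gauss_le f c -> gauss_le g d -> gauss_le (f * g) (c * d).
Proof.
move=> c0 d0 fc gd u.
have b0 : 0 <= c * d * expR (omega u) by rewrite !mulr_ge0 ?expR_ge0.
rewrite ga_coef_sum; apply: absv_sum_le => // x; rewrite ga_coef_sum.
apply: absv_sum_le => // y; rewrite ga_coef_monom.
case: eqP => [<-|_]; last by rewrite mulr0n absv0.
by rewrite raddfD expRD mulr1n absvM mulrACA ler_pM ?absv_ge0.
Qed.

Lemma gauss_le_monom a u : gauss_le (ga_monom a u) (v a * expR (- omega u)).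
Proof.
move=> x; rewrite ga_coef_monom; case: eqP => [<-|_].
  by rewrite -mulrA -expRD addNr expR0 mulr1.
by rewrite mulr0n absv0 !mulr_ge0 ?absv_ge0 ?expR_ge0.
Qed.

Lemma gauss_le_exists f : exists2 c, 0 <= c & gauss_le f c.
Proof.
rewrite (ga_sum f); elim: (enum_fset (ga_supp f)) => [|u s [c c0 IH]].
  by rewrite big_nil; exists 0 => // u; rewrite ga_coef0 absv0 mul0r.
rewrite big_cons; exists (Num.max (v (ga_coef u f) * expR (- omega u)) c).
  by rewrite le_max c0 orbT.
by apply: gauss_leD => //; exact: gauss_le_monom.
Qed.

Section QuotientGauge.
Variable X : ideal (grpalg K M).

Definition quotient_gauss_le f c : Prop :=
  0 <= c /\ exists2 g, ideal_set X g & gauss_le (f + g) c.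

(** The hypothesis enters through the size of 1: a bound [c] < 1 would come from some [g] in [X]
    with [1 + g] small. *)
Lemma quotient_gauge : (forall f, ideal_set X f -> ~ small v (1 + f)) ->
  gauge quotient_gauss_le.
Proof.
move=> nsmall; split.
- by move=> f c [].
- move=> f; have [c c0 fc] := gauss_le_exists f; exists c; split=> //.
  by exists 0; [exact: ideal0|rewrite addr0].
- split=> //; exists 0; first exact: ideal0.
  by move=> u; rewrite addr0 ga_coef0 absv0 mul0r.
- split=> //; exists 0; first exact: ideal0.
  have := @gauss_le_monom 1 0.
  by rewrite addr0 raddf0 oppr0 expR0 mulr1 absv1.
- move=> c [c0 [g Xg le]]; rewrite leNgt; apply/negP => c1.
  apply: (nsmall _ Xg) => u; rewrite (le_lt_trans (le u)) //.
  by rewrite gtr_pMl ?expR_gt0.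
- move=> f1 f2 c d [c0 [g1 Xg1 le1]] [d0 [g2 Xg2 le2]].
  split; first by rewrite le_max c0.
  exists (g1 + g2); first exact: idealD.
  by rewrite addrACA; exact: gauss_leD.
move=> f1 f2 c d [c0 [g1 Xg1 le1]] [d0 [g2 Xg2 le2]].
split; first exact: mulr_ge0.
(* This correction turns [f1 * f2] into the product of the two corrected representatives. *)
exists ((f1 + g1) * g2 + f2 * g1); first by apply: idealD; exact: idealM.
have -> : f1 * f2 + ((f1 + g1) * g2 + f2 * g1) = (f1 + g1) * (f2 + g2) by ring.
exact: gauss_leM.
Qed.

(** The Gauss norm bounds [p] from above on monomials. Nonzero monomials are units, and the bounds
    for one and its inverse multiply to 1, so both are equalities. *)
Lemma not_small_seminorm : (forall f, ideal_set X f -> ~ small v (1 + f)) ->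
  exists p : grpalg K M -> R, [/\ seminorm_ring p, {morph p : f g / f * g},
    forall f, ideal_set X f -> p f = 0, forall u, p (chi u) = expR (- omega u)
    & forall a : K, p a%:A = v a].
Proof.
move=> /quotient_gauge gB.
have [p [sp pM pB]] := bounded_multiplicative_seminorm (gauge_seminorm gB).
have pge0 := seminorm_ge0 sp.
have ple f c : quotient_gauss_le f c -> p f <= c.
  by move=> fc; rewrite (le_trans (pB f)) // gauge_inf_le.
have p_monom a u : p (ga_monom a u) <= v a * expR (- omega u).
  apply: ple; split; first by rewrite mulr_ge0 ?absv_ge0 ?expR_ge0.
  by exists 0; [exact: ideal0|rewrite addr0; exact: gauss_le_monom].
have p_monomE a u : p (ga_monom a u) = v a * expR (- omega u).
  have [->|a0] := eqVneq a 0; first by rewrite ga_monom0 (seminorm0 sp) absv0 mul0r.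
  apply/le_anti; rewrite p_monom /=.
  have va0 : 0 < v a by rewrite lt_neqAle eq_sym absv_eq0 a0 absv_ge0.
  have : p (ga_monom a u) * p (ga_monom a^-1 (- u)) = 1.
    by rewrite -pM ga_monomM mulfV // subrr -/(chi 0) chi0 (seminorm1 sp).
  have vaV : v a^-1 = (v a)^-1.
    by apply: (mulfI (lt0r_neq0 va0)); rewrite -absvM !mulfV ?absv1 // lt0r_neq0.
  have := p_monom a^-1 (- u); rewrite raddfN opprK vaV.
  move=> le e; have : 1 <= p (ga_monom a u) * ((v a)^-1 * expR (omega u)).
    by rewrite -{1}e ler_wpM2l.
  by rewrite -ler_pdivrMr ?mulr_gt0 ?invr_gt0 ?expR_gt0 // mul1r invfM invrK expRN.
exists p; split=> //.
- move=> f Xf; apply/le_anti; rewrite pge0 andbT; apply: ple; split=> //.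
  exists (- f); first by rewrite -mulN1r; exact: idealM.
  by move=> u; rewrite subrr ga_coef0 absv0 mul0r.
- by move=> u; rewrite p_monomE absv1 mul1r.
by move=> c; rewrite ga_scalarE p_monomE raddf0 oppr0 expR0 mulr1.
Qed.

End QuotientGauge.
End GaussNorm.

(** * Descent of smallness from [L] to [K] *)

Section Descent.
Context (K L : fieldType) (v : absval R K) (w : absval R L).
Context (j : {rmorphism K -> L}) (jE : forall x, w (j x) = v x).

(** The pivot is a term of [g] at which its Gauss norm is attained. *)
Lemma exists_pivot (g : grpalg K M) : g != 0 ->
  exists2 u0, ga_coef u0 g != 0 &
    forall u, v (ga_coef u g) * expR (omega u0) <= v (ga_coef u0 g) * expR (omega u).
Proof.
move=> g0; have [u1 u1g] : exists u1, u1 \in enum_fset (ga_supp g).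
  apply: contrapT => h; move/eqP: g0; apply; apply: ga_coefP => u.
  rewrite ga_coef0 ga_coef_outsupp //; apply/negP => ug; by apply: h; exists u.
have [u0 u0g u0max] := seq_argmax (fun u => v (ga_coef u g) * expR (- omega u)) u1g.
have u0_neq0 : ga_coef u0 g != 0 by rewrite /ga_coef mcoeff_neq0.
exists u0 => // u.
have [ug|ug] := boolP (u \in ga_supp g); last first.
  by rewrite (ga_coef_outsupp ug) absv0 mul0r mulr_ge0 ?absv_ge0 ?expR_ge0.
have := u0max u ug; rewrite !expRN ler_pdivrMr ?expR_gt0 // mulrAC.
by rewrite ler_pdivlMr ?expR_gt0.
Qed.

Definition combination (s : seq (L * grpalg K M)) : grpalg L M :=
  \sum_(x <- s) x.1 *: ga_map j x.2.

(* Gaussian elimination with a pivot of maximal absolute value does not increase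
   norms, so a small [L]-point of an affine subspace gives a small [K]-point. *)
Lemma small_descent (X : ideal (grpalg K M)) s (b : grpalg K M) :
  (forall x, x \in s -> ideal_set X x.2) ->
  small w (ga_map j b + combination s) ->
  exists2 f, ideal_set X f & small v (b + f).
Proof.
(* [b] is generalized, since eliminating a generator changes it as well. *)
elim: {s}(size s) {-2}s (erefl (size s)) b => [|n IH] [|[c g] s] //= => [_|[sn]] b.
  move=> _; rewrite /combination big_nil addr0 => bs; exists 0; first exact: ideal0.
  by move=> u; rewrite addr0 -jE -ga_coef_map.
move=> Xs; rewrite /combination big_cons /= -/(combination s) => small_y.
have Xg : ideal_set X g by exact: (Xs (c, g) (mem_head _ _)).
have Xs' x : x \in s -> ideal_set X x.2 by move=> xs; apply: Xs; rewrite inE xs orbT.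
have [g0|/exists_pivot[u0 gu0 gmax]] := eqVneq g 0.
  by apply: (IH s) => //; move: small_y; rewrite g0 rmorph0 scaler0 add0r.
set y := (X in small w X) in small_y.
pose e := (ga_coef u0 g)^-1 *: g.
have eu0 : ga_coef u0 e = 1 by rewrite ga_coefZ mulVf.
have Xe a : ideal_set X (a *: e).
  by rewrite scalerA -[g]mul1r ga_scalerAl; exact: idealM.
have gE : g = ga_coef u0 g *: e by rewrite scalerA mulfV // scale1r.
have e_le u : v (ga_coef u e) * expR (omega u0) <= expR (omega u).
  have vg0 : 0 < v (ga_coef u0 g) by rewrite lt_neqAle eq_sym absv_eq0 gu0 absv_ge0.
  rewrite -(ler_pM2l vg0) mulrA -absvM ga_coefZ mulrA mulfV // mul1r.
  exact: gmax.
(* [elimL] is linear, kills the image of [g] and agrees with [elimK] on elements coming from [K], so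
   the combination loses one generator. *)
pose elimK h := h - ga_coef u0 h *: e.
pose elimL (h : grpalg L M) := h - ga_coef u0 h *: ga_map j e.
have elimLD h1 h2 : elimL (h1 + h2) = elimL h1 + elimL h2.
  by rewrite /elimL ga_coefD scalerDl opprD addrACA.
have elimLZ a h : elimL (a *: h) = a *: elimL h.
  by rewrite /elimL ga_coefZ scalerBr scalerA.
have elim_map h : elimL (ga_map j h) = ga_map j (elimK h).
  apply: ga_coefP => u; rewrite /elimL /elimK !(ga_coefB, ga_coefZ, ga_coef_map).
  by rewrite rmorphB (rmorphM _ (ga_coef u0 h)).
have elimLg : elimL (ga_map j g) = 0.
  by rewrite elim_map /elimK -gE subrr rmorph0.
have elim_comb : elimL (combination s) =
    combination [seq (x.1, elimK x.2) | x <- s].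
  rewrite /combination big_map; elim: (s) => [|x s' IHs].
    by rewrite !big_nil /elimL ga_coef0 scale0r subrr.
  by rewrite !big_cons elimLD IHs elimLZ elim_map.
have small_elim : small w (elimL y).
  move=> u; rewrite ga_coefB ga_coefZ ga_coef_map.
  rewrite (le_lt_trans (absv_ultra _ _ _)) // gt_max small_y absvN absvM jE /=.
  have [->|eu] := eqVneq (ga_coef u e) 0; first by rewrite absv0 mulr0 expR_gt0.
  have ve : 0 < v (ga_coef u e) by rewrite lt_neqAle eq_sym absv_eq0 eu absv_ge0.
  by rewrite (lt_le_trans _ (e_le u)) // mulrC ltr_pM2l.
have := IH [seq (x.1, elimK x.2) | x <- s] _ (elimK b).
case=> [||| f Xf small_f].
- by rewrite size_map.
- move=> _ /mapP[x xs ->] /=; apply: idealD; first exact: Xs'.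
  by rewrite -scaleNr; exact: Xe.
- move: small_elim; rewrite /y !elimLD elimLZ elimLg scaler0 add0r.
  by rewrite elim_map elim_comb.
(* The multiple of [e] removed from [b] is moved over to [f]. *)
exists (f - ga_coef u0 b *: e); last by rewrite addrCA addrC.
by apply: idealD => //; rewrite -scaleNr; exact: Xe.
Qed.

End Descent.
End Smallness.

(** * Reduction and the initial ideal *)

Section Reduction.
Context (R : realType) (L : fieldType) (w : absval R L).

Lemma reduction_eq0 (x : valring w) : (reduction x == 0) = (w (valring_val x) < 1).
Proof.
rewrite -(rmorph0 (@reduction _ _ w)) /reduction.
by rewrite -[_ == _]Quotient.idealrBE subr0.
Qed.

Lemma reduction_surj (q : resfield w) : exists x : valring w, reduction x = q.
Proof. by exists (repr (q : {ideal_quot @maxideal _ _ w})); rewrite /reduction reprK. Qed.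

End Reduction.

(** Under a surjection the image of an ideal is already closed under multiplication by [B]. *)
Lemma ideal_ext_surj (A B : comNzRingType) (phi : {rmorphism A -> B})
    (I : ideal A) : (forall b, exists a, phi a = b) ->
  forall b, ideal_set (ideal_ext phi I) b -> exists2 a, ideal_set I a & phi a = b.
Proof.
move=> surj b; pose J : set B := phi @` I.
have J0 : J 0 by exists 0; [exact: ideal0|exact: rmorph0].
have JD x y : J x -> J y -> J (x + y).
  move=> [a Ia <-] [c Ic <-]; exists (a + c); first exact: idealD.
  exact: rmorphD.
have JM x y : J y -> J (x * y).
  move=> [c Ic <-]; have [a <-] := surj x; exists (a * c); first exact: idealM.
  exact: rmorphM.
by move=> /(_ (Ideal J0 JD JM)); exact.
Qed.

Section InitialIdeal.
Context (R : realType) (K : fieldType) (v : absval R K) (M : zmodType).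
Context (omega : {additive M -> R}) (D : point_over v omega).
Variable X : ideal (grpalg K M).

Let L := pt_ext D.
Let w := ext_abs L.
Let j := ext_map L.
Let t := pt D.

Lemma pt_abs u : w (t (chi u)) = expR (- omega u).
Proof.
have tu0 : t (chi u) != 0.
  apply: contra_eq_neq (rmorph1 t) => /= tu; rewrite -(chi_unit K u) rmorphM /= tu.
  by rewrite mul0r eq_sym oner_neq0.
have wu : 0 < w (t (chi u)) by rewrite lt_neqAle eq_sym absv_eq0 tu0 absv_ge0.
by rewrite -(pt_trop D) opprK lnK.
Qed.

Lemma ga_coef_translation u (h : grpalg L M) :
  ga_coef u (translation t h) = ga_coef u h * t (chi u).
Proof. exact: ga_morE. Qed.

(** Since [t (chi u)] has absolute value [expR (- omega u)], translation moves the weight [omega] to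
    0. *)
Lemma small_translation (h : grpalg L M) :
  small omega w h <-> forall u, w (ga_coef u (translation t h)) < 1.
Proof.
split=> sh u; have := sh u; rewrite ga_coef_translation absvM pt_abs expRN.
  by rewrite ltr_pdivrMr ?expR_gt0 // mul1r.
by rewrite ltr_pdivrMr ?expR_gt0 // mul1r.
Qed.

Lemma translation_surj (g : grpalg L M) : exists h, translation t h = g.
Proof.
apply: ga_mor_lift => u; exists (ga_coef u g * t (chi (- u))) => /=.
by rewrite -mulrA -rmorphM -chiD addNr chi0 rmorph1 mulr1.
Qed.

(** Combinations form an ideal: multiplying by a monomial puts its coefficient on the scalars and
    its character on the elements of [X]. *)
Lemma base_change_combination h : ideal_set (base_change L X) h ->
  exists2 s, forall x, x \in s -> ideal_set X x.2 & h = combination j s.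
Proof.
pose J : set (grpalg L M) := [set h | exists2 s,
  forall x, x \in s -> ideal_set X x.2 & h = combination j s].
have J0 : J 0 by exists [::] => //; rewrite /combination big_nil.
have JD x y : J x -> J y -> J (x + y).
  move=> [s Xs ->] [s' Xs' ->]; exists (s ++ s'); last by rewrite /combination big_cat.
  by move=> z; rewrite mem_cat => /orP[/Xs|/Xs'].
have JM x y : J y -> J (x * y).
  move=> [s Xs ->]; rewrite (ga_sum x) mulr_suml.
  elim: (enum_fset _) => [|u r IH]; first by rewrite big_nil.
  rewrite big_cons; apply: JD => //.
  exists [seq (ga_coef u x * z.1, chi u * z.2) | z <- s].
    by move=> _ /mapP[z zs ->] /=; apply: idealM; exact: Xs.
  rewrite /combination big_map mulr_sumr; apply: eq_bigr => z _ /=.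
  have -> : ga_monom (ga_coef u x) u = ga_coef u x *: ga_map j (chi u).
    apply: ga_coefP => v'; rewrite ga_coefZ ga_coef_map !ga_coef_monom.
    by case: eqP => _; rewrite ?mulr1n ?rmorph1 ?mulr1 ?mulr0n ?rmorph0 ?mulr0.
  rewrite rmorphM -ga_scalerAl -scalerA; congr (_ *: _).
  by rewrite mulrC -ga_scalerAl mulrC.
move=> /(_ (Ideal J0 JD JM)); apply=> _ [f Xf <-]; exists [:: (1, f)].
  by move=> x; rewrite inE => /eqP->.
by rewrite /combination big_seq1 scale1r.
Qed.

(** An element of the closure ideal that reduces to 1 differs from 1 by coefficients of absolute
    value < 1; undoing the translation gives a small [1 - h], which descends to [K]. Conversely the
    translate of a small [1 + f] reduces to 0, so that of [f] is integral and reduces to -1. *)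
Lemma init_at_unit : ideal_set (init_at D X) 1 <->
  exists2 f, ideal_set X f & small omega v (1 + f).
Proof.
split=> [|[f Xf small_f]].
  have red_surj (q : grpalg (resfield w) M) : exists F, ga_map (@reduction _ _ w) F = q.
    apply: ga_mor_lift => u; have [x <-] := reduction_surj (ga_coef u q).
    by exists x; rewrite mulr1.
  move=> /(ideal_ext_surj red_surj)[F].
  move=> /(ideal_ext_surj translation_surj)[h hX tE] FE.
  have [s Xs hE] := base_change_combination hX.
  have small_h : small omega w (1 - h).
    apply/small_translation => u; rewrite rmorphB rmorph1 /= tE.
    have -> : 1 - ga_map (@valring_val _ _ w) F = ga_map (@valring_val _ _ w) (1 - F).
      by rewrite rmorphB rmorph1.
    rewrite ga_coef_map -reduction_eq0 -(ga_coef_map (@reduction _ _ w)).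
    by rewrite rmorphB rmorph1 FE subrr ga_coef0.
  apply: (@small_descent _ _ omega _ _ v w j (ext_absE L) X [seq (- x.1, x.2) | x <- s]).
    by move=> _ /mapP[x xs ->]; exact: (Xs x).
  rewrite rmorph1; suff -> : combination j [seq (- x.1, x.2) | x <- s] = - h by [].
  rewrite hE /combination big_map -sumrN; apply: eq_bigr => x _ /=.
  by rewrite scaleNr.
have small_F : forall u, w (ga_coef u (translation t (1 + ga_map j f))) < 1.
  apply/small_translation => u; rewrite -(rmorph1 (ga_map j)) -rmorphD ga_coef_map.
  by rewrite ext_absE; exact: small_f.
pose G := translation t (ga_map j f).
have GE u : ga_coef u G = ga_coef u (translation t (1 + ga_map j f)) - ga_coef u 1.
  by rewrite rmorphD rmorph1 ga_coefD addrC addrA addNr add0r.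
have G_le1 u : ga_coef u G \in valring_pred w.
  rewrite inE GE (le_trans (absv_ultra _ _ _)) // ge_max (ltW (small_F u)) absvN.
  by rewrite ga_coef1; case: eqP => _; rewrite ?mulr1n ?mulr0n ?absv1 ?absv0 ?lexx ?ler01.
have [F FE] : exists F, ga_map (@valring_val _ _ w) F = G.
  by apply: ga_mor_lift => u; exists (ValRing (G_le1 u)); rewrite mulr1.
have -> : 1 = -1 * ga_map (@reduction _ _ w) F.
  apply/eqP; rewrite mulN1r -addr_eq0 -(rmorph1 (ga_map (@reduction _ _ w))) -rmorphD.
  apply/eqP/ga_coefP => u; rewrite ga_coef0 ga_coef_map; apply/eqP.
  rewrite reduction_eq0 -(ga_coef_map (@valring_val _ _ w)) rmorphD rmorph1 /= FE.
  by have := small_F u; rewrite rmorphD rmorph1.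
move=> J SJ; apply: idealM; apply: SJ; exists F => //.
rewrite /= /closure_ideal /= /preimage /= FE => J' SJ'; apply: SJ'.
by exists (ga_map j f) => // J'' SJ''; apply: SJ''; exists f.
Qed.

End InitialIdeal.

(** * Points of the tropical variety *)

Section TropicalPoints.
Context (R : realType) (K : fieldType) (v : absval R K) (M : zmodType).

(** Integers have value at most 1 because they come from [K], so the binomial expansion bounds
    [p (f + g) ^+ n] by [n.+1] times the n-th power of the maximum. [le1_of_expr_bounded] removes
    the linear factor. *)
Lemma torus_an_ultra (p : torus_an v M) f g : p (f + g) <= Num.max (p f) (p g).
Proof.
have p_nat n : p n%:R <= 1.
  have -> : n%:R = (n%:R : K)%:A :> grpalg K M by rewrite -[RHS]/(in_alg _ _) rmorph_nat.
  rewrite (sn_ext p); elim: n => [|n IH]; first by rewrite absv0 ler01.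
  by rewrite -natr1 (le_trans (absv_ultra _ _ _)) // ge_max IH absv1 lexx.
have p1 : p 1 = 1 by rewrite -(absv1 v) -(sn_ext p) /torus_scalar scale1r.
have p0 : p 0 = 0 by rewrite -(absv0 v) -(sn_ext p) /torus_scalar scale0r.
have pX h n : p (h ^+ n) = p h ^+ n.
  by elim: n => [|n IH]; rewrite ?expr0 ?p1 // !exprS snM IH.
have pge0 := sn_ge0 p.
have p_sum (I : Type) (r : seq I) F : p (\sum_(i <- r) F i) <= \sum_(i <- r) p (F i).
  elim: r => [|i r IH]; first by rewrite !big_nil p0.
  by rewrite !big_cons (le_trans (snD _ _ _)) // lerD2l.
set m := Num.max _ _; have m0 : 0 <= m by rewrite le_max pge0.
have bound n : p (f + g) ^+ n <= m ^+ n * n.+1%:R.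
  rewrite -pX exprDn (le_trans (p_sum _ _ _)) //.
  rewrite (le_trans (_ : _ <= \sum_(i < n.+1) m ^+ n)) //.
    apply: ler_sum => i _; rewrite -mulr_natl !snM !pX.
    have -> : m ^+ n = 1 * (m ^+ (n - i) * m ^+ i).
      by rewrite mul1r -exprD subnK // leq_ord.
    by rewrite !ler_pM ?mulr_ge0 ?exprn_ge0 // lerXn2r ?nnegrE // le_max lexx ?orbT.
  by rewrite sumr_const card_ord mulr_natr.
have [m_0|m_neq0] := eqVneq m 0.
  by have := bound 1%N; rewrite !expr1 m_0 mul0r.
have m_gt0 : 0 < m by rewrite lt_neqAle eq_sym m_neq0.
rewrite -[leRHS]mul1r -ler_pdivrMr //; apply: (@le1_of_expr_bounded _ 1) => n.
by rewrite expr_div_n ler_pdivrMr ?exprn_gt0 // mul1r mulrC.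
Qed.

Lemma tropical_varietyP (X : ideal (grpalg K M)) (omega : {additive M -> R}) :
  tropical_variety v X omega <->
  forall f, ideal_set X f -> ~ small omega v (1 + f).
Proof.
split=> [[p _ <-] f Xf small_f|nsmall].
  pose P := an_incl p; have P1 : P 1 = 1.
    by rewrite -(absv1 v) -(sn_ext P) /torus_scalar scale1r.
  have P0 : P 0 = 0 by rewrite -(absv0 v) -(sn_ext P) /torus_scalar scale0r.
  have PN h : P h = 0 -> P (- h) = 0 by move=> h0; rewrite -mulN1r snM h0 mulr0.
  have Pf : P f = 0.
    by rewrite -P0 /P /=; congr (p _); apply/coord_eq; rewrite subr0.
  (* Each term of [1 + f] has value < 1 at [P], and [P] is ultrametric. *)
  have P_lt1 : P (1 + f) < 1.
    rewrite (ga_sum (1 + f)); elim: (enum_fset _) => [|u s IH].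
      by rewrite big_nil P0 ltr01.
    rewrite big_cons (le_lt_trans (torus_an_ultra _ _ _)) // gt_max IH andbT.
    have -> : ga_monom (ga_coef u (1 + f)) u = (ga_coef u (1 + f))%:A * chi u.
      by rewrite ga_scalarE ga_monomM add0r mulr1.
    have := small_f u; rewrite snM (sn_ext P) /= /trop_fun.
    rewrite expRN lnK ?posrE ?sn_chi_gt0 //.
    by rewrite -(ltr_pdivlMr _ _ (sn_chi_gt0 P u)) div1r.
  have : P 1 <= Num.max (P (1 + f)) (P (- f)).
    by rewrite -{1}(addrK f 1) torus_an_ultra.
  by rewrite P1 (PN _ Pf) leNgt gt_max P_lt1 ltr01.
have [p [sp pM pX p_chi p_scalar]] := not_small_seminorm nsmall.
(* [p] vanishes on [X], so its value on a representative depends only on the class. *)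
pose pbar (q : coord_ring X) := p (repr q).
have pbarE f : pbar (Defs.coord X f) = p f.
  by apply: (mult_seminorm_eq sp pM); apply: pX; apply/coord_eq; exact: coordK.
have pbar_ge0 q : 0 <= pbar q by exact: (seminorm_ge0 sp).
have pbarD q1 q2 : pbar (q1 + q2) <= pbar q1 + pbar q2.
  rewrite -(coordK q1) -(coordK q2) -rmorphD !pbarE.
  rewrite (le_trans (seminormD sp _ _)) // ge_max lerDl lerDr.
  by rewrite !(seminorm_ge0 sp).
have pbarM q1 q2 : pbar (q1 * q2) = pbar q1 * pbar q2.
  by rewrite -(coordK q1) -(coordK q2) -rmorphM !pbarE pM.
have pbar_ext c : pbar ((Defs.coord X \o @torus_scalar K M) c) = v c.
  by rewrite /= pbarE p_scalar.
exists (Seminorm pbar_ge0 pbarD pbarM pbar_ext) => //.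
apply: additive_ext => u; rewrite /= /trop_fun /= pbarE p_chi.
by rewrite expRK opprK.
Qed.

(** For the zero ideal [not_small_seminorm] applies, as 1 is not small. The resulting seminorm gives
    the field [L], and the images of the characters in it give [t]. Existence keeps the statement
    over every choice from being vacuous. *)
Lemma point_over_exists (omega : {additive M -> R}) : inhabited (point_over v omega).
Proof.
pose zero : set (grpalg K M) := [set 0].
have zeroD f g : zero f -> zero g -> zero (f + g) by move=> -> ->; exact: addr0.
have zeroM f g : zero g -> zero (f * g) by move=> ->; exact: mulr0.
have [f -> /(_ 0)|p [sp pM _ p_chi p_scalar]] :=
  @not_small_seminorm _ _ omega _ v (Ideal (erefl : zero 0) zeroD zeroM).
  by rewrite addr0 ga_coef1 eqxx raddf0 expR0 absv1 ltxx.
have [L [w [j wj]]] := seminorm_valued_field sp pM.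
pose iota : {rmorphism K -> L} := j \o (@GRing.in_alg K (grpalg K M)).
have iotaE c : w (iota c) = v c by rewrite /= wj p_scalar.
pose E := ValuedExt iotaE.
have jE c : j c%:A = ext_map E c by [].
pose t : torus_point (ext_map E) M := TorusPoint jE.
have tE u : - ln (ext_abs E (t (chi u))) = omega u.
  by rewrite /= wj p_chi expRK opprK.
by split; exact: (PointOver tE).
Qed.

End TropicalPoints.

(* in_omega(X) depends on a choice of (L, w) and t; that its non-emptiness does
   not is expressed by stating the equality both for some and for every choice. *)
Theorem theorem5p6 (R : realType) (K : fieldType) (v : absval R K)
    (M : zmodType) (hM : free_of_finite_rank M) (X : ideal (grpalg K M)) :
  tropical_variety v X =
    [set omega | exists D : point_over v omega, points (init_at D X) !=set0]
  /\
  tropical_variety v X =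
    [set omega | forall D : point_over v omega, points (init_at D X) !=set0].
Proof.
(* Any single choice [D] decides membership, so the existence of one gives both equalities. *)
have initP omega (D : point_over v omega) :
    points (init_at D X) !=set0 <-> tropical_variety v X omega.
  rewrite (points_neq0 _ R) init_at_unit tropical_varietyP; split=> [h f Xf sf|h [f]].
    by apply: h; exists f.
  exact: h.
by split; apply/seteqP; split=> omega /=;
  have [D0] := point_over_exists v omega;
  [move=> ?; exists D0; apply/initP|case=> D /initP|move=> ? D; apply/initP|
   move=> /(_ D0)/initP].
Qed.
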